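(* Let $0<p\le 1$. Let $I$ be an interval of $\mathbb R$ equipped with the $p$-metric $\rho(x,y)=|x-y|^{1/p}$ for $x,y\in I$. Then $\mathcal F_p(I)$ is isometrically isomorphic to $L_p(I)$. To be precise, if $a$ is the base point of $I$, the map $\delta_I(x)\mapsto\chi_{(a,x]}$, $x\in I$, extends to a linear isometry of $\mathcal F_p(I)$ onto $L_p(I)$.
   Context: All vector spaces are real. $L_p(I)$ is taken with respect to Lebesgue measure with the $p$-norm $\|f\|_p=(\int_I|f|^p)^{1/p}$, and the convention $\chi_{(a,x]}=-\chi_{(x,a]}$ is used when $x<a$. For $0<p\le 1$, a $p$-metric on a set $\mathcal{M}$ is a symmetric map $\rho\colon\mathcal M\times\mathcal M\to[0,\infty)$ with $\rho(x,y)=0$ iff $x=y$ and $\rho(x,y)^p\le\rho(x,z)^p+\rho(z,y)^p$ for all $x,y,z$. A pointed space has a distinguished point (base point), denoted $0$ in general. A $p$-norm on a vector space $Y$ is a map $\|\cdot\|_Y\colon Y\to[0,\infty)$, vanishing only at $0$, with $\|\alpha y\|_Y=|\alpha|\|y\|_Y$ and $\|y+z\|_Y^p\le\|y\|_Y^p+\|z\|_Y^p$. A map $f\colon\mathcal M\to Y$ is $1$-Lipschitz if $\|f(x)-f(y)\|_Y\le\rho(x,y)$ for all $x,y$. Let $(\mathcal M,\rho)$ be a pointed $p$-metric space, let $\mathbb R_0^{\mathcal M}$ be the space of all functions $f\colon\mathcal M\to\mathbb R$ vanishing at the base point, let $\delta_{\mathcal M}(x)$ be the linear functional on $\mathbb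 R_0^{\mathcal M}$ given by $\langle\delta_{\mathcal M}(x),f\rangle=f(x)$, and let $\mathcal P(\mathcal M)$ be the linear span of $\{\delta_{\mathcal M}(x)\colon x\in\mathcal M\}$. For $\mu=\sum_{j=1}^N a_j\delta_{\mathcal M}(x_j)$ put $$\|\mu\|_{\mathcal F_p(\mathcal M)}=\sup\Big\|\sum_{j=1}^N a_jf(x_j)\Big\|_Y,$$ the supremum being over all $p$-normed spaces $Y$ and all $1$-Lipschitz maps $f\colon\mathcal M\to Y$ sending the base point to $0$. This is a $p$-norm on $\mathcal P(\mathcal M)$, and the Lipschitz free $p$-space $\mathcal F_p(\mathcal M)$ is the completion of $\mathcal P(\mathcal M)$ with respect to it. *)

(* Defs.v *)
From HB Require Import structures.
From mathcomp Require Import all_boot all_order all_algebra.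
From mathcomp Require Import all_classical all_reals all_analysis.
From mathcomp Require Import ring_quotient measurable_realfun.

Set Implicit Arguments.
Unset Strict Implicit.
Unset Printing Implicit Defensive.

Import Order.TTheory GRing.Theory Num.Theory.
Import numFieldNormedType.Exports.

Local Open Scope classical_set_scope.
Local Open Scope ring_scope.

Record pexponent (R : realType) := PExponent {
  pexp_val :> R;
  pexp_itv : 0 < pexp_val <= 1 }.

Section pexponent_theory.
Variables (R : realType) (p : pexponent R).

Lemma pexp_gt0 : 0 < p :> R. Proof. by case/andP: (pexp_itv p). Qed.
Lemma pexp_le1 : p <= 1 :> R. Proof. by case/andP: (pexp_itv p). Qed.
Lemma pexp_ge0 : 0 <= p :> R. Proof. exact: ltW pexp_gt0. Qed.
Lemma pexp_neq0 : (p : R) != 0. Proof. by rewrite gt_eqF// pexp_gt0. Qed.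

Lemma powRpK (x : R) : 0 <= x -> (x `^ p) `^ (p : R)^-1 = x.
Proof. by move=> x0; rewrite -powRrM mulfV ?pexp_neq0// powRr1. Qed.

Lemma powRVpK (x : R) : 0 <= x -> (x `^ (p : R)^-1) `^ p = x.
Proof. by move=> x0; rewrite -powRrM mulVf ?pexp_neq0// powRr1. Qed.

Lemma ler_powp (x y : R) : 0 <= x -> x <= y -> x `^ p <= y `^ p.
Proof.
move=> x0 xy; apply: ge0_ler_powR; rewrite ?nnegrE ?pexp_ge0//.
exact: le_trans xy.
Qed.

Lemma ltr_powp (x y : R) : 0 <= x -> x < y -> x `^ p < y `^ p.
Proof.
move=> x0 xy; apply: gt0_ltr_powR; rewrite ?nnegrE ?pexp_gt0//.
exact: le_trans (ltW xy).
Qed.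

Lemma ler_powp_inv (x y : R) : 0 <= y -> x `^ p <= y `^ p -> x <= y.
Proof.
by move=> y0; apply: contra_le => yx; exact: ltr_powp.
Qed.

Lemma powRp_subadd (x y : R) : 0 <= x -> 0 <= y ->
  (x + y) `^ p <= x `^ p + y `^ p.
Proof.
move=> x0 y0; have [->|xN0] := eqVneq x 0.
  by rewrite add0r powR0 ?pexp_neq0// add0r.
have xgt0 : 0 < x by rewrite lt_neqAle eq_sym xN0.
have [->|yN0] := eqVneq y 0.
  by rewrite addr0 powR0 ?pexp_neq0// addr0.
have ygt0 : 0 < y by rewrite lt_neqAle eq_sym yN0.
have s0 : 0 < x + y by exact: addr_gt0.
have H (z : R) : 0 < z -> z <= x + y -> (x + y) `^ p * (z / (x + y)) <= z `^ p.
  move=> z0 zs.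
  have {2}-> : z = (x + y) * (z / (x + y)) by rewrite mulrC mulfVK ?gt_eqF.
  rewrite powRM ?divr_ge0 ?(ltW z0) ?(ltW s0)// ler_wpM2l ?powR_ge0//.
  by rewrite ger1_powR ?pexp_le1// divr_gt0//= ler_pdivrMr// mul1r.
have := lerD (H _ xgt0 _) (H _ ygt0 _).
rewrite -mulrDr -mulrDl mulfV ?gt_eqF// mulr1; apply.
  by rewrite lerDl.
by rewrite lerDr.
Qed.

End pexponent_theory.

HB.mixin Record Lmodule_isPNormed (R : realType) (p : pexponent R) V
    of GRing.Lmodule R V := {
  pnorm : V -> R;
  pnorm_ge0 : forall x, 0 <= pnorm x;
  pnorm0_eq0 : forall x, pnorm x = 0 -> x = 0;
  pnormZ : forall (a : R) x, pnorm (a *: x) = `|a| * pnorm x;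
  pnormD : forall x y, pnorm (x + y) `^ p <= pnorm x `^ p + pnorm y `^ p
}.

#[short(type=pnormedType)]
HB.structure Definition PNormed (R : realType) (p : pexponent R) :=
  {V of Lmodule_isPNormed R p V & GRing.Lmodule R V}.

Section lquot.
Variables (R : pzRingType) (V : lmodType R) (S : submodClosed V).
Local Open Scope quotient_scope.

Definition lquot_pred : {pred V} := S.

HB.instance Definition _ := GRing.isZmodClosed.Build V lquot_pred
  (GRing.submod_closedB (submodClosedP S)).

Definition lquot : Type := Quotient.quot lquot_pred.
HB.instance Definition _ := GRing.Zmodule.on lquot.
HB.instance Definition _ := EqQuotient.on lquot.

Definition lquot_pi (v : V) : lquot := \pi_lquot v.

Lemma lquot_piP (v w : V) : lquot_pi v = lquot_pi w <-> v - w \in S.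
Proof.
change (lquot_pi v = lquot_pi w <-> v - w \in lquot_pred).
by rewrite Quotient.idealrBE; split=> [H|/eqP//]; apply/eqP.
Qed.

Lemma lquot_reprK (q : lquot) : lquot_pi (repr q) = q.
Proof. exact: reprK. Qed.

Lemma lquot_piD : {morph lquot_pi : v w / v + w}.
Proof. by move=> v w; rewrite /lquot_pi; rewrite (@Quotient.pi_add _ lquot_pred). Qed.

Definition lquot_scale (a : R) (q : lquot) : lquot := lquot_pi (a *: repr q).

Lemma lquot_piZ a v : lquot_pi (a *: v) = lquot_scale a (lquot_pi v).
Proof.
apply/lquot_piP; rewrite -scalerBr rpredZ//.
by apply/lquot_piP; rewrite lquot_reprK.
Qed.

Lemma lquot_scaleA a b q :
  lquot_scale a (lquot_scale b q) = lquot_scale (a * b) q.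
Proof.
by rewrite -[q]lquot_reprK -!lquot_piZ scalerA.
Qed.

Lemma lquot_scale1 : left_id 1 lquot_scale.
Proof. by move=> q; rewrite -[q]lquot_reprK -!lquot_piZ scale1r. Qed.

Lemma lquot_scaleDr : right_distributive lquot_scale +%R.
Proof.
move=> a q r; rewrite -[q]lquot_reprK -[r]lquot_reprK.
by rewrite -lquot_piD -!lquot_piZ -lquot_piD scalerDr.
Qed.

Lemma lquot_scaleDl q : {morph lquot_scale^~ q : a b / a + b}.
Proof.
by move=> a b; rewrite -[q]lquot_reprK -!lquot_piZ -lquot_piD scalerDl.
Qed.

HB.instance Definition _ := GRing.Zmodule_isLmodule.Build R lquot
  lquot_scaleA lquot_scale1 lquot_scaleDr lquot_scaleDl.

Lemma lquot_pi_is_linear : linear lquot_pi.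
Proof. by move=> a v w; rewrite lquot_piD lquot_piZ. Qed.

HB.instance Definition _ := GRing.isLinear.Build R V lquot _ lquot_pi
  lquot_pi_is_linear.

End lquot.

(* A p-seminorm whose null vectors are exactly those of S descends to a p-norm
   on V / S. *)
Section pquot_norm.
Variables (R : realType) (p : pexponent R) (V : lmodType R) (S : submodClosed V).
Variable N : V -> R.
Hypotheses (N0 : forall x, 0 <= N x)
  (NZ : forall (a : R) x, N (a *: x) = `|a| * N x)
  (ND : forall x y, N (x + y) `^ p <= N x `^ p + N y `^ p)
  (NS : forall x, N x = 0 <-> x \in S).

Definition lquot_norm (q : lquot S) : R := N (repr q).

Lemma lquot_normE v : lquot_norm (lquot_pi S v) = N v.
Proof.
have E x y : x - y \in S -> N x <= N y.
  move=> /NS xy0; apply: (@ler_powp_inv _ p) => //.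
  by rewrite -{1}(subrK y x) (le_trans (ND _ _))// xy0 powR0 ?pexp_neq0// add0r.
apply/eqP; rewrite eq_le /lquot_norm; apply/andP; split; apply: E.
  by apply/lquot_piP; rewrite lquot_reprK.
by apply/lquot_piP; rewrite lquot_reprK.
Qed.

Lemma lquot_norm_ge0 q : 0 <= lquot_norm q. Proof. exact: N0. Qed.

Lemma lquot_norm0_eq0 q : lquot_norm q = 0 -> q = 0.
Proof.
rewrite -[q]lquot_reprK lquot_normE => /NS qS.
by rewrite -(linear0 (lquot_pi S)); apply/lquot_piP; rewrite subr0.
Qed.

Lemma lquot_normZ (a : R) q : lquot_norm (a *: q) = `|a| * lquot_norm q.
Proof. by rewrite -[q]lquot_reprK -linearZ !lquot_normE NZ. Qed.

Lemma lquot_normD q r :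
  lquot_norm (q + r) `^ p <= lquot_norm q `^ p + lquot_norm r `^ p.
Proof.
by rewrite -[q]lquot_reprK -[r]lquot_reprK -linearD !lquot_normE ND.
Qed.

End pquot_norm.

(* L_p(D, mu) for 0 < p <= 1 (the library's Lspace requires 1 <= p): total
   functions whose restriction to D is measurable and p-integrable, modulo
   equality almost everywhere on D. *)
Section Lp.
Context d (T : measurableType d) (R : realType).
Variables (p : pexponent R) (mu : {measure set T -> \bar R}).
Variables (D : set T) (mD : measurable D).

Definition pintegrable (f : T -> R) : Prop :=
  measurable_fun D f /\ (\int[mu]_(x in D) (`|f x| `^ p)%:E < +oo)%E.

Definition pseminorm (f : T -> R) : R :=
  (fine (\int[mu]_(x in D) (`|f x| `^ p)%:E)) `^ (p : R)^-1.

Definition ae_zero (f : T -> R) : Prop := ae_eq mu D f (cst 0).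

Lemma measurable_normpowp (f : T -> R) : measurable_fun D f ->
  measurable_fun D (fun x => (`|f x| `^ p)%:E).
Proof.
move=> mf; apply/measurable_EFinP.
apply: (measurableT_comp (measurable_powR _)).
exact: measurableT_comp.
Qed.

Lemma pintegralZ a (f : T -> R) : measurable_fun D f ->
  (\int[mu]_(x in D) (`|a * f x| `^ p)%:E =
   (`|a| `^ p)%:E * \int[mu]_(x in D) (`|f x| `^ p)%:E)%E.
Proof.
move=> mf; rewrite -ge0_integralZl_EFin ?powR_ge0//; last 1 first.
- exact: measurable_normpowp.
by apply: eq_integral => x _; rewrite normrM powRM.
Qed.

Lemma pintegralD (f g : T -> R) : measurable_fun D f -> measurable_fun D g ->
  (\int[mu]_(x in D) (`|f x + g x| `^ p)%:E <=
   \int[mu]_(x in D) (`|f x| `^ p)%:E + \int[mu]_(x in D) (`|g x| `^ p)%:E)%E.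
Proof.
move=> mf mg; rewrite -ge0_integralD//.
- apply: ge0_le_integral => //.
  + by apply: measurable_normpowp; exact: measurable_funD.
  + by apply: emeasurable_funD; exact: measurable_normpowp.
  + move=> x _; rewrite -EFinD lee_fin.
    apply: le_trans (powRp_subadd _ _ _) => //.
    exact: ler_powp (ler_normD _ _).
- exact: measurable_normpowp.
- exact: measurable_normpowp.
Qed.

Lemma pintegral_ge0 (f : T -> R) :
  (0 <= \int[mu]_(x in D) (`|f x| `^ p)%:E)%E.
Proof. by apply: integral_ge0 => x _; rewrite lee_fin powR_ge0. Qed.

Lemma pintegral_fin (f : T -> R) : pintegrable f ->
  (\int[mu]_(x in D) (`|f x| `^ p)%:E)%E \is a fin_num.
Proof. by case=> _ fi; rewrite ge0_fin_numE// pintegral_ge0. Qed.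

Lemma pseminorm_powp (f : T -> R) : pintegrable f ->
  ((pseminorm f `^ p)%:E = \int[mu]_(x in D) (`|f x| `^ p)%:E)%E.
Proof.
move=> fi; rewrite /pseminorm powRVpK ?fine_ge0 ?pintegral_ge0//.
by rewrite fineK// pintegral_fin.
Qed.

Definition Lpfun_pred of measurable D : {pred T -> R} :=
  fun f => `[< pintegrable f >].

Lemma Lpfun_submod_closed : submod_closed (Lpfun_pred mD).
Proof.
split.
  apply/asboolP; split; first exact: measurable_cst.
  rewrite integral0_eq// => x _.
  by rewrite normr0 powR0 ?pexp_neq0.
move=> a f g /asboolP[mf fi] /asboolP[mg gi]; apply/asboolP.
have maf : measurable_fun D (fun x => a * f x) by exact: measurable_funM.
split; first exact: measurable_funD.
apply: le_lt_trans (pintegralD maf mg) _.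
rewrite pintegralZ//; apply: lte_add_pinfty; last exact: gi.
apply: lte_mul_pinfty; [|by rewrite fin_numE|exact: fi].
by rewrite lee_fin powR_ge0.
Qed.

HB.instance Definition _ := GRing.isSubmodClosed.Build R (T -> R : lmodType R)
  (Lpfun_pred mD) Lpfun_submod_closed.

Record Lpfun := MkLpfun {
  Lpfun_val :> T -> R;
  Lpfun_prop : Lpfun_val \in Lpfun_pred mD }.

HB.instance Definition _ := [isSub for Lpfun_val].
HB.instance Definition _ := [Choice of Lpfun by <:].
HB.instance Definition _ := [SubChoice_isSubLmodule of Lpfun by <:].

Lemma LpfunP (f : Lpfun) : pintegrable f.
Proof. by apply/asboolP; exact: (Lpfun_prop f). Qed.

Lemma pseminorm0P (f : Lpfun) : pseminorm f = 0 <-> ae_zero f.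
Proof.
have fi := LpfunP f; have [mf _] := fi.
have -> : pseminorm f = 0 <->
    (\int[mu]_(x in D) `|(`|f x| `^ p)%:E| = 0)%E.
  rewrite (_ : (\int[mu]_(x in D) _ = (pseminorm f `^ p)%:E)%E); last first.
    rewrite pseminorm_powp//; apply: eq_integral => x _.
    by rewrite gee0_abs ?lee_fin ?powR_ge0.
  split=> [->|[/powR_eq0_eq0//]].
  by rewrite powR0 ?pexp_neq0.
rewrite ae_eq_integral_abs//; last exact: measurable_normpowp.
split; apply: filterS => x /[swap] Dx /(_ Dx).
  by move=> [/powR_eq0_eq0/eqP]; rewrite normr_eq0 => /eqP.
by move=> ->; rewrite /= normr0 powR0 ?pexp_neq0.
Qed.

Lemma Lpfun_normZ (a : R) (f : Lpfun) : pseminorm (a *: f) = `|a| * pseminorm f.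
Proof.
have [mf _] := LpfunP f; rewrite /pseminorm.
rewrite (_ : (\int[mu]_(x in D) _ =
   (`|a| `^ p)%:E * \int[mu]_(x in D) (`|f x| `^ p)%:E)%E); last first.
  by rewrite -pintegralZ.
rewrite fineM// ?pintegral_fin//; last exact: LpfunP.
by rewrite powRM ?powR_ge0 ?fine_ge0 ?pintegral_ge0// powRpK.
Qed.

Lemma Lpfun_normD (f g : Lpfun) :
  pseminorm (f + g) `^ p <= pseminorm f `^ p + pseminorm g `^ p.
Proof.
have H := pintegralD (LpfunP f).1 (LpfunP g).1.
rewrite -(pseminorm_powp (LpfunP f)) -(pseminorm_powp (LpfunP g)) in H.
rewrite -EFinD in H.
rewrite -lee_fin; apply: le_trans H.
by have /= -> := pseminorm_powp (LpfunP (f + g)).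
Qed.

Definition Lpnull_pred : {pred Lpfun} := fun f => `[< ae_zero f >].

Lemma Lpnull_submod_closed : submod_closed Lpnull_pred.
Proof.
split; first by apply/asboolP; exact: ae_eq_refl.
move=> a f g /asboolP f0 /asboolP g0; apply/asboolP.
move: f0 g0; apply: filterS2 => x f0 g0 Dx /=.
change (a * f x + g x = 0).
by rewrite f0// g0//= mulr0 addr0.
Qed.

HB.instance Definition _ := GRing.isSubmodClosed.Build R Lpfun Lpnull_pred
  Lpnull_submod_closed.

Definition Lp : Type := lquot Lpnull_pred.
HB.instance Definition _ := GRing.Lmodule.on Lp.

Let Lpnull0 (f : Lpfun) : pseminorm f = 0 <-> f \in Lpnull_pred.
Proof. by rewrite pseminorm0P; split=> [?|/asboolP//]; apply/asboolP. Qed.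

Let pseminorm_ge0 (f : Lpfun) : 0 <= pseminorm f. Proof. exact: powR_ge0. Qed.

Definition Lpnorm : Lp -> R := @lquot_norm R Lpfun Lpnull_pred pseminorm.

HB.instance Definition _ := @Lmodule_isPNormed.Build R p Lp Lpnorm
  (lquot_norm_ge0 pseminorm_ge0)
  (lquot_norm0_eq0 pseminorm_ge0 Lpfun_normD Lpnull0)
  (lquot_normZ pseminorm_ge0 Lpfun_normZ Lpfun_normD Lpnull0)
  (lquot_normD pseminorm_ge0 Lpfun_normD Lpnull0).

Lemma Lpfun_mem (f : T -> R) : pintegrable f -> f \in Lpfun_pred mD.
Proof. by move=> ?; apply/asboolP. Qed.

Definition Lp_class (f : T -> R) (fi : pintegrable f) : Lp :=
  lquot_pi Lpnull_pred (MkLpfun (Lpfun_mem fi)).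

Lemma Lp_normE (f : T -> R) (fi : pintegrable f) :
  pnorm (Lp_class fi) = (fine (\int[mu]_(x in D) (`|f x| `^ p)%:E)) `^ (p : R)^-1.
Proof. exact: (lquot_normE pseminorm_ge0 Lpfun_normD Lpnull0). Qed.

Lemma Lp_classP (f g : T -> R) (fi : pintegrable f) (gi : pintegrable g) :
  Lp_class fi = Lp_class gi <-> ae_eq mu D f g.
Proof.
rewrite lquot_piP; split.
  move=> /asboolP; apply: filterS => x /[apply]; change (f x - g x = 0 -> f x = g x).
  by move/eqP; rewrite subr_eq0 => /eqP.
move=> fg; apply/asboolP; move: fg; apply: filterS => x /[apply].
by change (f x = g x -> f x - g x = 0) => ->; rewrite subrr.
Qed.

End Lp.

Section pnorm_theory.
Variables (R : realType) (p : pexponent R) (V : pnormedType p).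
Implicit Types x y : V.

Lemma pnorm0 : pnorm (0 : V) = 0.
Proof. by rewrite -(scale0r (0 : V)) pnormZ normr0 mul0r. Qed.

Lemma pnormN x : pnorm (- x) = pnorm x.
Proof. by rewrite -scaleN1r pnormZ normrN1 mul1r. Qed.

Lemma pnormBC x y : pnorm (x - y) = pnorm (y - x).
Proof. by rewrite -opprB pnormN. Qed.

Lemma ler_pnorm_dist x y :
  `|pnorm x `^ p - pnorm y `^ p| <= pnorm (x - y) `^ p.
Proof.
rewrite ler_norml; apply/andP; split.
  rewrite lerNl opprB lerBlDr pnormBC.
  by apply: le_trans (pnormD _ _); rewrite subrK.
by rewrite lerBlDr; apply: le_trans (pnormD _ _); rewrite subrK.
Qed.

Lemma pnormD_lt x y e : 0 < e -> pnorm x < (e `^ p / 2) `^ (p : R)^-1 ->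
  pnorm y < (e `^ p / 2) `^ (p : R)^-1 -> pnorm (x + y) < e.
Proof.
move=> e0 /(ltr_powp p (pnorm_ge0 _)) xe /(ltr_powp p (pnorm_ge0 _)) ye.
have h0 : 0 <= e `^ p / 2 by rewrite divr_ge0// powR_ge0.
rewrite powRVpK// in xe; rewrite powRVpK// in ye.
rewrite ltNge; apply/negP => /(ler_powp p (ltW e0)).
rewrite leNgt => /negP; apply.
apply: le_lt_trans (pnormD _ _) _.
by rewrite [ltRHS]splitr; exact: ltrD.
Qed.

End pnorm_theory.

(* Completion: Cauchy sequences modulo null sequences, normed by the limit of
   the norms. *)
Section pcompletion.
Variables (R : realType) (p : pexponent R) (V : pnormedType p).

Definition pcauchy (u : nat -> V) : Prop :=
  forall e : R, 0 < e -> exists N : nat, forall m n : nat,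
    (N <= m)%N -> (N <= n)%N -> pnorm (u m - u n) < e.

Definition pcauchy_pred : {pred nat -> V} := fun u => `[< pcauchy u >].

Lemma pcauchy_submod_closed : submod_closed pcauchy_pred.
Proof.
split.
  by apply/asboolP => e e0; exists 0%N => m n _ _; rewrite subrr pnorm0.
move=> a u v /asboolP cu /asboolP cv; apply/asboolP => e e0.
set h := (e `^ p / 2) `^ (p : R)^-1.
have h0 : 0 < h by rewrite powR_gt0// divr_gt0// powR_gt0.
have a0 : 0 < `|a| + 1 by rewrite ltr_pwDr.
have [Nu Hu] := cu _ (divr_gt0 h0 a0); have [Nv Hv] := cv _ h0.
exists (maxn Nu Nv) => m n; rewrite !geq_max => /andP[um vm] /andP[un vn].
change (pnorm (a *: u m + v m - (a *: u n + v n)) < e).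
rewrite opprD addrACA -scalerBr; apply: pnormD_lt => //; last exact: Hv.
rewrite pnormZ; apply: (@le_lt_trans _ _ ((`|a| + 1) * pnorm (u m - u n))).
  by rewrite ler_wpM2r ?pnorm_ge0// lerDl.
by rewrite mulrC -ltr_pdivlMr//; exact: Hu.
Qed.

HB.instance Definition _ := GRing.isSubmodClosed.Build R (nat -> V : lmodType R)
  pcauchy_pred pcauchy_submod_closed.

Record pcauchyseq := MkPcauchyseq {
  pcauchyseq_val :> nat -> V;
  pcauchyseq_prop : pcauchyseq_val \in pcauchy_pred }.

HB.instance Definition _ := [isSub for pcauchyseq_val].
HB.instance Definition _ := [Choice of pcauchyseq by <:].
HB.instance Definition _ := [SubChoice_isSubLmodule of pcauchyseq by <:].

Implicit Types u v : pcauchyseq.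

Lemma pcauchyseqP u : pcauchy u.
Proof. by apply/asboolP; exact: pcauchyseq_prop u. Qed.

Definition pnorm_lim u : R := limn (fun n => pnorm (u n)).

Lemma cvg_pnorm_powp u : cvgn (fun n => pnorm (u n) `^ p).
Proof.
apply/cauchy_cvgP/cauchyP => e e0.
have [N HN] := pcauchyseqP u (powR_gt0 (p : R)^-1 e0).
exists (pnorm (u N) `^ p); exists N => // n Nn /=.
apply: le_lt_trans (ler_pnorm_dist _ _) _.
by rewrite -[e](@powRVpK R p) ?(ltW e0)// ltr_powp ?pnorm_ge0// HN.
Qed.

Lemma cvg_pnorm_root u : (fun n => pnorm (u n)) @ \oo -->
  limn (fun n => pnorm (u n) `^ p) `^ (p : R)^-1.
Proof.
set L := limn _; have cL : (fun n => pnorm (u n) `^ p) @ \oo --> L.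
  exact: cvg_pnorm_powp.
have L0 : 0 <= L.
  by apply: limr_ge; [exact: cvg_pnorm_powp|near=> n; exact: powR_ge0].
set l := L `^ _; have l0 : 0 <= l by exact: powR_ge0.
have lL : l `^ p = L by rewrite powRVpK.
apply/cvgrPdist_lt => e e0.
have up : \forall n \near \oo, pnorm (u n) `^ p < (l + e) `^ p.
  by apply: (cvgr_lt _ cL); rewrite -lL ltr_powp// ltrDl.
have lo : \forall n \near \oo, l - e < pnorm (u n).
  have [le0|le0] := ltP (l - e) 0.
    by near=> n; exact: lt_le_trans le0 (pnorm_ge0 _).
  have : \forall n \near \oo, (l - e) `^ p < pnorm (u n) `^ p.
    by apply: (cvgr_gt _ cL); rewrite -lL ltr_powp// ltrBlDr ltrDl.
  apply: filterS => n H; rewrite ltNge; apply/negP.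
  by move=> /(ler_powp p (pnorm_ge0 _)); rewrite leNgt H.
near=> n; rewrite distrC ltr_norml; apply/andP; split.
  by rewrite ltrBrDl; near: n.
rewrite ltrBlDl ltNge; apply/negP.
move=> /(ler_powp p (addr_ge0 l0 (ltW e0))); rewrite leNgt => /negP; apply.
by near: n.
Unshelve. all: by end_near. Qed.

Lemma cvg_pnorm u : (fun n => pnorm (u n)) @ \oo --> pnorm_lim u.
Proof. by apply/cvg_ex; eexists; exact: cvg_pnorm_root. Qed.

Lemma pnorm_lim_ge0 u : 0 <= pnorm_lim u.
Proof.
apply: limr_ge; first exact: cvg_pnorm.
by near=> n; exact: pnorm_ge0.
Unshelve. all: by end_near. Qed.

Lemma cvg_pnorm_lim_powp u :
  (fun n => pnorm (u n) `^ p) @ \oo --> pnorm_lim u `^ p.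
Proof.
have -> : pnorm_lim u = limn (fun n => pnorm (u n) `^ p) `^ (p : R)^-1.
  by apply: cvg_lim => //; exact: cvg_pnorm_root.
rewrite powRVpK; first exact: cvg_pnorm_powp.
by apply: limr_ge; [exact: cvg_pnorm_powp|near=> n; exact: powR_ge0].
Unshelve. all: by end_near. Qed.

Lemma pnorm_limZ (a : R) u : pnorm_lim (a *: u) = `|a| * pnorm_lim u.
Proof.
apply: (@cvg_lim R^o) => //.
under eq_fun do rewrite pnormZ.
by apply: cvgMr; exact: cvg_pnorm.
Qed.

Lemma pnorm_limD u v :
  pnorm_lim (u + v) `^ p <= pnorm_lim u `^ p + pnorm_lim v `^ p.
Proof.
apply: (ler_cvg_to (@cvg_pnorm_lim_powp (u + v))
  (cvgD (@cvg_pnorm_lim_powp u) (@cvg_pnorm_lim_powp v))).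
by near=> n; exact: pnormD.
Unshelve. all: by end_near. Qed.

Definition pnull_pred : {pred pcauchyseq} :=
  fun u => `[< (fun n => pnorm (u n)) @ \oo --> (0 : R) >].

Lemma pnorm_lim0 u : pnorm_lim u = 0 <-> u \in pnull_pred.
Proof.
split=> [u0|/asboolP u0]; last exact: (@cvg_lim R^o).
by apply/asboolP; rewrite -u0; exact: cvg_pnorm.
Qed.

Lemma pnull_submod_closed : submod_closed pnull_pred.
Proof.
have lim0 : pnorm_lim 0 = 0.
  by rewrite -(scale0r (0 : pcauchyseq)) pnorm_limZ normr0 mul0r.
split; first exact/pnorm_lim0.
move=> a u v /pnorm_lim0 u0 /pnorm_lim0 v0; apply/pnorm_lim0.
apply/eqP; rewrite eq_le pnorm_lim_ge0 andbT.
apply: (@ler_powp_inv _ p) => //; apply: le_trans (pnorm_limD _ _) _.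
by rewrite pnorm_limZ u0 v0 mulr0 powR0 ?pexp_neq0// addr0.
Qed.

HB.instance Definition _ := GRing.isSubmodClosed.Build R pcauchyseq pnull_pred
  pnull_submod_closed.

Definition pcompletion : Type := lquot pnull_pred.
HB.instance Definition _ := GRing.Lmodule.on pcompletion.

Definition pcompletion_norm : pcompletion -> R :=
  @lquot_norm R pcauchyseq pnull_pred pnorm_lim.

HB.instance Definition _ := @Lmodule_isPNormed.Build R p pcompletion
  pcompletion_norm
  (lquot_norm_ge0 pnorm_lim_ge0)
  (lquot_norm0_eq0 pnorm_lim_ge0 pnorm_limD pnorm_lim0)
  (lquot_normZ pnorm_lim_ge0 pnorm_limZ pnorm_limD pnorm_lim0)
  (lquot_normD pnorm_lim_ge0 pnorm_limD pnorm_lim0).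

Lemma pcauchy_cst (x : V) : (fun=> x) \in pcauchy_pred.
Proof. by apply/asboolP => e e0; exists 0%N => m n _ _; rewrite subrr pnorm0. Qed.

Definition pcompletion_in (x : V) : pcompletion :=
  lquot_pi pnull_pred (MkPcauchyseq (pcauchy_cst x)).

Lemma pcompletion_in_is_linear : linear pcompletion_in.
Proof.
move=> a x y; rewrite /pcompletion_in -linearP; congr (lquot_pi _ _).
exact: val_inj.
Qed.

HB.instance Definition _ := GRing.isLinear.Build R V pcompletion _ pcompletion_in
  pcompletion_in_is_linear.

Lemma pcompletion_normE u : pnorm (lquot_pi pnull_pred u : pcompletion) =
  limn (fun n => pnorm (u n)).
Proof. exact: (lquot_normE pnorm_lim_ge0 pnorm_limD pnorm_lim0). Qed.

Lemma pcompletion_in_norm (x : V) : pnorm (pcompletion_in x) = pnorm x.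
Proof. by rewrite pcompletion_normE /= lim_cst. Qed.

Lemma pcompletion_in_dense (q : pcompletion) (e : R) : 0 < e ->
  exists x : V, pnorm (q - pcompletion_in x) < e.
Proof.
move=> e0; rewrite -[q]lquot_reprK; move: (repr q) => u.
have e20 : 0 < e / 2 by rewrite divr_gt0.
have [N HN] := pcauchyseqP u e20.
exists (u N); rewrite -linearB pcompletion_normE.
apply: (@le_lt_trans _ _ (e / 2)); last by rewrite gtr_pMr// invf_lt1// ltr1n.
apply: limr_le; first exact: cvg_pnorm.
by exists N => // n /= Nn; apply/ltW; exact: HN.
Qed.

End pcompletion.

Arguments pcompletion {R p} V.

Lemma pcompletion_complete (R : realType) (p : pexponent R) (V : pnormedType p)
    (q : nat -> pcompletion V) : pcauchy q ->
  exists l : pcompletion V, forall e : R, 0 < e -> exists N : nat,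
    forall n : nat, (N <= n)%N -> pnorm (q n - l) < e.
Proof.
move=> cq.
have h_gt0 (e : R) : 0 < e -> 0 < (e `^ p / 2) `^ (p : R)^-1.
  by move=> e0; rewrite powR_gt0// divr_gt0// powR_gt0.
have /choice[x Hx] : forall n : nat, exists x : V,
    pnorm (q n - pcompletion_in x) < n.+1%:R^-1.
  by move=> n; apply: pcompletion_in_dense; rewrite invr_gt0.
have small (e : R) : 0 < e -> exists N : nat, forall n : nat, (N <= n)%N ->
    pnorm (q n - pcompletion_in (x n)) < e.
  move=> e0; have [N _ HN] := near_infty_natSinv_lt (PosNum e0).
  by exists N => n Nn; apply: lt_trans (Hx n) _; exact: HN.
have cx : pcauchy x.
  move=> e e0; have h0 := h_gt0 _ e0; have hh0 := h_gt0 _ h0.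
  have [N1 H1] := small _ hh0; have [N2 H2] := cq _ hh0.
  have [N3 H3] := small _ h0.
  exists (maxn N1 (maxn N2 N3)) => m n; rewrite !geq_max.
  move=> /and3P[m1 m2 m3] /and3P[n1 n2 n3].
  rewrite -pcompletion_in_norm linearB /=.
  have -> : pcompletion_in (x m) - pcompletion_in (x n) =
     ((pcompletion_in (x m) - q m) + (q m - q n)) + (q n - pcompletion_in (x n)).
    by rewrite !addrA !subrK.
  apply: (@pnormD_lt R p (pcompletion V) _ _ _ e0 _ (H3 n n3)).
  apply: (@pnormD_lt R p (pcompletion V) _ _ _ h0 _ (H2 m n m2 n2)).
  by rewrite pnormBC; exact: (H1 m m1).
have xP : x \in @pcauchy_pred R p V by apply/asboolP.
exists (lquot_pi (@pnull_pred _ _ V) (MkPcauchyseq xP)) => e e0.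
have h0 := h_gt0 _ e0.
have h20 : 0 < (e `^ p / 2) `^ (p : R)^-1 / 2 by rewrite divr_gt0.
have [N1 H1] := small _ h0; have [N2 H2] := cx _ h20.
exists (maxn N1 N2) => n; rewrite geq_max => /andP[n1 n2].
rewrite -[q n](subrK (pcompletion_in (x n))) -addrA.
apply: (@pnormD_lt R p (pcompletion V) _ _ _ e0 (H1 n n1)).
rewrite /pcompletion_in -linearB pcompletion_normE.
apply: (@le_lt_trans _ _ ((e `^ p / 2) `^ (p : R)^-1 / 2)); last first.
  by rewrite gtr_pMr// invf_lt1// ltr1n.
apply: limr_le; first exact: cvg_pnorm.
by exists N2 => // k /= Nk; apply/ltW; exact: H2.
Qed.

Section chi.
Variables (R : realType) (p : pexponent R).
Implicit Types a x t : R.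

(* chi_(a,x], with the convention chi_(a,x] = - chi_(x,a] when x < a. *)
Definition chi a x : R -> R :=
  if a <= x then \1_(`]a, x]%classic) else \- \1_(`]x, a]%classic).

Lemma chiE a x t : chi a x t = (t <= x)%R%:R - (t <= a)%R%:R.
Proof.
rewrite /chi; case: (leP a x) => ax /=; rewrite indicE mem_setE in_itv /=.
  case: (leP t a) => ta /=; last by rewrite subr0.
  by rewrite (le_trans ta ax) subrr.
case: (leP t x) => tx /=; last by rewrite sub0r.
by rewrite (le_trans tx (ltW ax)) subrr oppr0.
Qed.

Lemma chiB a x z t : chi a x t - chi a z t = chi z x t.
Proof. by rewrite !chiE opprB addrA subrK. Qed.

Lemma measurable_chi a x (D : set (measurableTypeR R)) :
  measurable_fun D (chi a x : measurableTypeR R -> R).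
Proof.
rewrite /chi; case: ifP => _; last apply: measurableT_comp => //;
  by apply: measurable_indic.
Qed.

Lemma normr_chi_powp a x t :
  `|chi a x t| `^ p = \1_(`]Num.min a x, Num.max a x]%classic) t.
Proof.
rewrite /chi; case: leP => ax /=; rewrite ?normrN indicE; case: (_ \in _);
  by rewrite ?normr1 ?normr0 ?powR1 ?powR0 ?pexp_neq0.
Qed.

Lemma pintegral_chi a x (D : set (measurableTypeR R)) : measurable D ->
  (\int[lebesgue_measure]_(t in D) (`|chi a x t| `^ p)%:E =
   lebesgue_measure (`]Num.min a x, Num.max a x]%classic `&` D))%E.
Proof.
move=> mD; under eq_integral do rewrite normr_chi_powp.
by rewrite integral_indic.
Qed.

Lemma pintegral_chi_le a x (D : set (measurableTypeR R)) : measurable D ->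
  (\int[lebesgue_measure]_(t in D) (`|chi a x t| `^ p)%:E <= `|x - a|%:E)%E.
Proof.
move=> mD; rewrite pintegral_chi//.
apply: (@le_trans _ _
    (lebesgue_measure (`]Num.min a x, Num.max a x]%classic : set R))).
  apply: le_measure; rewrite ?inE//.
    by apply: measurableI.
rewrite lebesgue_measure_itv/= lte_fin; case: ifP => // _.
rewrite -EFinB lee_fin; case: (leP a x) => ax; first exact: ler_norm.
by rewrite distrC ler_norm.
Qed.

Lemma pintegral_chiT a x :
  (\int[lebesgue_measure]_(t in (setT : set (measurableTypeR R)))
     (`|chi a x t| `^ p)%:E = `|x - a|%:E)%E.
Proof.
rewrite pintegral_chi// setIT lebesgue_measure_itv/= lte_fin.
case: (leP a x) => ax.
  rewrite ger0_norm ?subr_ge0//; case: ifPn => [//|].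
  by rewrite -leNgt => xa; rewrite (@le_anti _ _ a x) ?ax// subrr.
by rewrite ax ltr0_norm ?subr_lt0// opprB.
Qed.

Lemma pintegrable_chi a x (D : set (measurableTypeR R)) : measurable D ->
  pintegrable p (@lebesgue_measure R) D (chi a x).
Proof.
move=> mD; split; first exact: measurable_chi.
by apply: le_lt_trans (pintegral_chi_le _ _ mD) _; rewrite ltry.
Qed.

End chi.

HB.mixin Record isPMetric (R : realType) (p : pexponent R) M of Choice M := {
  pdist : M -> M -> R;
  pdist_ge0 : forall x y, 0 <= pdist x y;
  pdist_sym : forall x y, pdist x y = pdist y x;
  pdist_eq0 : forall x y, pdist x y = 0 <-> x = y;
  pdist_triangle : forall x y z,
    pdist x y `^ p <= pdist x z `^ p + pdist z y `^ p
}.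

#[short(type=pmetricType)]
HB.structure Definition PMetric (R : realType) (p : pexponent R) :=
  {M of isPMetric R p M & Choice M}.

(* The pointed space is M with base point x0. *)
Section free_space.
Variables (R : realType) (p : pexponent R) (M : pmetricType p) (x0 : M).

Definition based_fun : Type := {f : M -> R | f x0 = 0}.

Definition delta (x : M) : based_fun -> R := fun f => sval f x.

Definition delta_comb (s : seq (R * M)) : based_fun -> R :=
  \sum_(q <- s) q.1 *: delta q.2.

(* The linear span of the delta's is taken inside all functions
   based_fun -> R; its elements are automatically linear functionals. *)
Definition delta_span_pred : {pred based_fun -> R} :=
  fun m => `[< exists s, m = delta_comb s >].

Lemma delta_span_submod_closed : submod_closed delta_span_pred.
Proof.
split; first by apply/asboolP; exists [::]; rewrite /delta_comb big_nil.
move=> a _ _ /asboolP[s ->] /asboolP[t ->]; apply/asboolP.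
exists ([seq (a * q.1, q.2) | q <- s] ++ t).
rewrite /delta_comb big_cat big_map scaler_sumr /=; congr (_ + _).
by apply: eq_bigr => q _; rewrite scalerA.
Qed.

HB.instance Definition _ := GRing.isSubmodClosed.Build R
  (based_fun -> R : lmodType R) delta_span_pred delta_span_submod_closed.

Record delta_span := MkDeltaSpan {
  delta_span_val :> based_fun -> R;
  delta_span_prop : delta_span_val \in delta_span_pred }.

HB.instance Definition _ := [isSub for delta_span_val].
HB.instance Definition _ := [Choice of delta_span by <:].
HB.instance Definition _ := [SubChoice_isSubLmodule of delta_span by <:].

Definition lipschitz1 (Y : pnormedType p) (f : M -> Y) : Prop :=
  forall x y, pnorm (f x - f y) <= pdist x y.

(* The value below does not depend on the chosen expression of m as a
   combination of the delta's; see free_normE. *)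
Definition free_norm_set (m : based_fun -> R) : set R :=
  [set r | exists (s : seq (R * M)) (Y : pnormedType p) (f : M -> Y),
    [/\ m = delta_comb s, lipschitz1 f, f x0 = 0 &
        r = pnorm (\sum_(q <- s) q.1 *: f q.2)]].

Definition free_norm (m : based_fun -> R) : R := sup (free_norm_set m).

Definition weight (s : seq (R * M)) (y : M) : R := \sum_(q <- s | q.2 == y) q.1.

Lemma comb_weight (Y : lmodType R) (f : M -> Y) (s : seq (R * M)) (U : seq M) :
  uniq U -> {subset [seq q.2 | q <- s] <= U} ->
  \sum_(q <- s) q.1 *: f q.2 = \sum_(y <- U) weight s y *: f y.
Proof.
move=> uU sU; rewrite (eq_bigr (fun y => \sum_(q <- s | q.2 == y) q.1 *: f q.2)).
  rewrite (exchange_big_dep xpredT)//= big_seq [RHS]big_seq.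
  apply: eq_bigr => q qs; rewrite (big_rem q.2) /=; last first.
    by apply: sU; apply/mapP; exists q.
  rewrite eqxx big1_seq ?addr0// => y /andP[/eqP <-].
  by rewrite mem_rem_uniqF.
by move=> y _; rewrite scaler_suml; apply: eq_bigr => q /eqP ->.
Qed.

Definition based_indic (y : M) : M -> R := fun x => ((x == y) && (y != x0))%:R.

Lemma based_indic0 y : based_indic y x0 = 0.
Proof. by rewrite /based_indic eq_sym; case: (y == x0). Qed.

Lemma delta_combE s (f : based_fun) :
  delta_comb s f = \sum_(q <- s) q.1 * sval f q.2.
Proof.
rewrite /delta_comb; elim/big_ind2: _ => //= _ a _ b <- <-.
by [].
Qed.

Lemma weightE s y : y != x0 ->
  weight s y = delta_comb s (exist _ (based_indic y) (based_indic0 y)).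
Proof.
move=> y0; rewrite delta_combE /weight big_mkcond; apply: eq_bigr => q _ /=.
by rewrite /based_indic y0 andbT; case: (q.2 == y); rewrite ?mulr1 ?mulr0.
Qed.

Lemma delta_comb_inj (Y : lmodType R) (f : M -> Y) s t : f x0 = 0 ->
  delta_comb s = delta_comb t ->
  \sum_(q <- s) q.1 *: f q.2 = \sum_(q <- t) q.1 *: f q.2.
Proof.
move=> f0 st.
set U := undup ([seq q.2 | q <- s] ++ [seq q.2 | q <- t]).
rewrite (@comb_weight _ f s U) ?undup_uniq//; last first.
  by move=> x xs; rewrite mem_undup mem_cat xs.
rewrite (@comb_weight _ f t U) ?undup_uniq//; last first.
  by move=> x xs; rewrite mem_undup mem_cat xs orbT.
apply: eq_bigr => y _; have [->|y0] := eqVneq y x0; first by rewrite f0 !scaler0.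
by rewrite !weightE// st.
Qed.

Lemma free_normE s : free_norm (delta_comb s) =
  sup [set r | exists (Y : pnormedType p) (f : M -> Y),
    [/\ lipschitz1 f, f x0 = 0 & r = pnorm (\sum_(q <- s) q.1 *: f q.2)]].
Proof.
congr sup; apply/seteqP; split=> r.
  move=> [t [Y [f [st lf f0 ->]]]]; exists Y, f; split=> //.
  by rewrite (delta_comb_inj f0 st).
by move=> [Y [f [lf f0 ->]]]; exists s, Y, f.
Qed.

Lemma free_norm_ub s r : free_norm_set (delta_comb s) r ->
  r <= (\sum_(q <- s) (`|q.1| * pdist q.2 x0) `^ p) `^ (p : R)^-1.
Proof.
move=> [t [Y [f [st lf f0 ->]]]]; rewrite -(delta_comb_inj f0 st).
apply: (@ler_powp_inv _ p); first exact: powR_ge0.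
rewrite powRVpK; last by apply: sumr_ge0 => q _; exact: powR_ge0.
elim/big_ind2: _ => [|y1 r1 y2 r2 h1 h2|q _].
- by rewrite pnorm0 powR0 ?pexp_neq0.
- by apply: le_trans (pnormD _ _) _; exact: lerD.
- rewrite pnormZ ler_powp ?mulr_ge0 ?pnorm_ge0// ler_wpM2l//.
  by have := lf q.2 x0; rewrite f0 subr0.
Qed.

Lemma free_norm_has_ub m : m \in delta_span_pred -> has_ubound (free_norm_set m).
Proof. by move=> /asboolP[s ->]; eexists => r; exact: free_norm_ub. Qed.

Let LpR : pnormedType p := Lp p (@lebesgue_measure R) measurableT.

Lemma free_norm_set0 m : m \in delta_span_pred -> free_norm_set m 0.
Proof.
move=> /asboolP[s ->]; exists s, LpR, (fun=> 0); split=> //.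
  by move=> x y; rewrite subrr pnorm0 pdist_ge0.
by rewrite big1 ?pnorm0// => q _; rewrite scaler0.
Qed.

Lemma free_norm_ge0 (m : delta_span) : 0 <= free_norm m.
Proof.
apply: ub_le_sup; first exact/free_norm_has_ub/delta_span_prop.
exact/free_norm_set0/delta_span_prop.
Qed.

Lemma free_normZ_le (a : R) (m : delta_span) :
  free_norm (a *: m) <= `|a| * free_norm m.
Proof.
apply: ge_sup; first by exists 0; exact: (free_norm_set0 (delta_span_prop (a *: m))).
move=> _ [t [Y [f [st lf f0 ->]]]].
have /asboolP[s ms] := delta_span_prop m.
have E : delta_comb [seq (a * q.1, q.2) | q <- s] = delta_comb t.
  have am : delta_span_val (a *: m) = a *: delta_span_val m by [].
  rewrite -st am ms.
  rewrite /delta_comb big_map scaler_sumr; apply: eq_bigr => q _.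
  by rewrite scalerA.
rewrite -(delta_comb_inj f0 E) big_map.
rewrite (eq_bigr (fun q => a *: (q.1 *: f q.2))); last first.
  by move=> q _; rewrite scalerA.
rewrite -scaler_sumr pnormZ ler_wpM2l//.
apply: ub_le_sup; first exact/free_norm_has_ub/delta_span_prop.
by exists s, Y, f.
Qed.

Lemma free_normZ (a : R) (m : delta_span) :
  free_norm (a *: m) = `|a| * free_norm m.
Proof.
apply/eqP; rewrite eq_le free_normZ_le andTb.
have [->|a0] := eqVneq a 0; first by rewrite normr0 mul0r free_norm_ge0.
rewrite -ler_pdivlMl ?normr_gt0// -normfV.
by have := free_normZ_le a^-1 (a *: m); rewrite scalerA mulVf// scale1r.
Qed.

Lemma free_normD (m n : delta_span) :
  free_norm (m + n) `^ p <= free_norm m `^ p + free_norm n `^ p.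
Proof.
set K := leRHS; have K0 : 0 <= K by rewrite addr_ge0 ?powR_ge0.
rewrite -[K](@powRVpK R p)//; apply: ler_powp; first exact: free_norm_ge0.
apply: ge_sup; first by exists 0; exact: (free_norm_set0 (delta_span_prop (m + n))).
move=> _ [t [Y [f [st lf f0 ->]]]].
have /asboolP[s ms] := delta_span_prop m.
have /asboolP[u nu] := delta_span_prop n.
have E : delta_comb (s ++ u) = delta_comb t.
  have mn : delta_span_val (m + n) = delta_span_val m + delta_span_val n by [].
  by rewrite -st mn ms nu /delta_comb big_cat.
rewrite -(delta_comb_inj f0 E) big_cat /=.
apply: (@ler_powp_inv _ p); first exact: powR_ge0.
rewrite powRVpK//; apply: le_trans (pnormD _ _) _.
apply: lerD; apply: ler_powp; rewrite ?pnorm_ge0//; apply: ub_le_sup.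
- exact/free_norm_has_ub/delta_span_prop.
- by exists s, Y, f.
- exact/free_norm_has_ub/delta_span_prop.
- by exists u, Y, f.
Qed.

(* Distinct points are separated by 1-Lipschitz maps into L_p(R) of the form
   x |-> chi_(0, max(0, e - rho(x, y)^p)]. *)
Section bump.
Variables (y : M) (e : R).

Let g (x : M) : R := Num.max 0 (e - pdist x y `^ p).

Let bump (x : M) : LpR :=
  Lp_class measurableT (pintegrable_chi p 0 (g x) measurableT).

Lemma bump_dist (x z : M) : `|g x - g z| <= pdist x z `^ p.
Proof.
have H (u v : M) : g u - g v <= pdist u v `^ p.
  rewrite lerBlDr ge_max; apply/andP; split.
    by rewrite addr_ge0 ?powR_ge0// le_max lexx.
  apply: (@le_trans _ _ (pdist u v `^ p + (e - pdist v y `^ p))).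
    rewrite addrCA lerD2l lerBrDr addrC lerBlDr.
    by rewrite (pdist_sym u v); exact: pdist_triangle.
  by rewrite lerD2l le_max lexx orbT.
rewrite ler_norml H andbT lerNl opprB.
by rewrite pdist_sym; exact: H.
Qed.

Lemma bump_class0 (x : M) : g x = 0 -> bump x = 0.
Proof.
move=> gx0; rewrite -[RHS](linear0 (lquot_pi (@Lpnull_pred _ _ _ p _ _ measurableT))).
apply/lquot_piP; rewrite subr0; apply/asboolP.
by apply: aeW => t _ /=; rewrite gx0 chiE subrr.
Qed.

Lemma bump_lipschitz1 : lipschitz1 bump.
Proof.
move=> x z; apply: (@ler_powp_inv _ p); first exact: pdist_ge0.
apply: le_trans (bump_dist x z).
have -> : bump x - bump z =
    Lp_class measurableT (pintegrable_chi p (g z) (g x) measurableT).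
  rewrite /bump /Lp_class -linearB; congr (lquot_pi _ _); apply: val_inj.
  by apply/funext => t; exact: chiB.
rewrite Lp_normE powRVpK ?fine_ge0 ?pintegral_ge0//.
by rewrite pintegral_chiT.
Qed.

Lemma bump_center : 0 < e -> pnorm (bump y) `^ p = e.
Proof.
move=> e0; rewrite Lp_normE powRVpK ?fine_ge0 ?pintegral_ge0//.
rewrite pintegral_chiT/= subr0 /g (pdist_eq0 y y).2// powR0 ?pexp_neq0// subr0.
by rewrite (max_idPr (ltW e0)) gtr0_norm.
Qed.

Lemma bump_far (x : M) : e <= pdist x y `^ p -> bump x = 0.
Proof.
move=> ex; apply: bump_class0; rewrite /g; apply/max_idPl.
by rewrite subr_le0.
Qed.

Lemma free_norm0_weight s : y != x0 -> 0 < e -> free_norm (delta_comb s) = 0 ->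
  (forall x, x \in x0 :: [seq q.2 | q <- s] -> x != y -> e <= pdist x y `^ p) ->
  weight s y = 0.
Proof.
move=> y0 e0 s0 sep.
have b0 : bump x0 = 0.
  by apply/bump_far/sep; rewrite ?mem_head// eq_sym.
have : pnorm (\sum_(q <- s) q.1 *: bump q.2) <= 0.
  rewrite -s0; apply: ub_le_sup.
    by apply: free_norm_has_ub; apply/asboolP; exists s.
  by exists s, LpR, bump; split=> //; exact: bump_lipschitz1.
have -> : \sum_(q <- s) q.1 *: bump q.2 = weight s y *: bump y.
  rewrite /weight scaler_suml [RHS]big_mkcond big_seq [RHS]big_seq.
  apply: eq_bigr => q qs; case: eqVneq => [->//|qy].
  rewrite bump_far ?scaler0//; apply: sep => //.
  by rewrite inE map_f ?orbT.
rewrite pnormZ => c0; have : `|weight s y| * pnorm (bump y) = 0.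
  by apply/eqP; rewrite eq_le c0 mulr_ge0 ?pnorm_ge0.
move=> /eqP; rewrite mulf_eq0 normr_eq0 => /orP[/eqP//|/eqP by0].
by move: (bump_center e0); rewrite by0 powR0 ?pexp_neq0// => /esym/eqP; rewrite gt_eqF.
Qed.

End bump.

Lemma free_norm0_eq0 (m : delta_span) : free_norm m = 0 -> m = 0.
Proof.
have /asboolP[s ms] := delta_span_prop m; rewrite ms => s0.
apply: val_inj; rewrite /= ms; apply/funext => f; rewrite delta_combE.
rewrite (_ : \sum_(q <- s) _ = \sum_(q <- s) q.1 *: (sval f q.2 : R^o))//.
rewrite (@comb_weight _ _ s (undup [seq q.2 | q <- s])) ?undup_uniq//; last first.
  by move=> x; rewrite mem_undup.
rewrite big1// => y _; have [->|y0] := eqVneq y x0.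
  by rewrite (svalP f) scaler0.
pose e : R := \big[Num.min/1]_(x <- x0 :: [seq q.2 | q <- s] | x != y)
  (pdist x y `^ p).
rewrite (@free_norm0_weight y e)// ?scale0r//.
  rewrite /e; elim/big_ind: _ => // [u v u0 v0|x xy].
    by rewrite lt_min u0.
  rewrite powR_gt0// lt_neqAle pdist_ge0 andbT eq_sym.
  by apply: contra xy => /eqP /pdist_eq0 ->.
move=> x xs xy; rewrite /e.
exact: bigmin_inf_seq xs xy _.
Qed.

HB.instance Definition _ := @Lmodule_isPNormed.Build R p delta_span
  (fun m : delta_span => free_norm m)
  free_norm_ge0 free_norm0_eq0 free_normZ free_normD.

Lemma delta_in_span (x : M) : delta x \in delta_span_pred.
Proof.
apply/asboolP; exists [:: (1, x)].
by rewrite /delta_comb big_seq1 scale1r.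
Qed.

Definition lipfree : Type := pcompletion delta_span.
HB.instance Definition _ := PNormed.on lipfree.

Definition lipfree_delta (x : M) : lipfree :=
  pcompletion_in (MkDeltaSpan (delta_in_span x)).

End free_space.

Section interval_pmetric.
Variables (R : realType) (p : pexponent R) (I : interval R).

(* p only selects the p-metric carried by this copy of I. *)
Definition itv_point (_ : pexponent R) (J : interval R) : Type :=
  {x : R | x \in J}.
HB.instance Definition _ := Choice.on (itv_point p I).

Definition itv_pdist (x y : itv_point p I) : R :=
  `|val x - val y| `^ (p : R)^-1.

Lemma itv_pdist_ge0 x y : 0 <= itv_pdist x y.
Proof. exact: powR_ge0. Qed.

Lemma itv_pdist_sym x y : itv_pdist x y = itv_pdist y x.
Proof. by rewrite /itv_pdist distrC. Qed.

Lemma itv_pdist_eq0 x y : itv_pdist x y = 0 <-> x = y.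
Proof.
split=> [/powR_eq0_eq0/eqP|->].
  by rewrite normr_eq0 subr_eq0 => /eqP; exact: val_inj.
by rewrite /itv_pdist subrr normr0 powR0// invr_eq0 pexp_neq0.
Qed.

Lemma itv_pdist_triangle x y z :
  itv_pdist x y `^ p <= itv_pdist x z `^ p + itv_pdist z y `^ p.
Proof. by rewrite /itv_pdist !powRVpK// ler_distD. Qed.

HB.instance Definition _ := @isPMetric.Build R p (itv_point p I) itv_pdist
  itv_pdist_ge0 itv_pdist_sym itv_pdist_eq0 itv_pdist_triangle.

Lemma measurable_itvR : measurable ([set` I] : set (measurableTypeR R)).
Proof. exact: measurable_itv. Qed.

Definition Lp_itv : Type := Lp p (@lebesgue_measure R) measurable_itvR.
HB.instance Definition _ := PNormed.on Lp_itv.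

Definition Lp_chi (a x : R) : Lp_itv :=
  Lp_class measurable_itvR (pintegrable_chi p a x measurable_itvR).

End interval_pmetric.

(* Main.v *)
From HB Require Import structures.
Require Import Defs.
From mathcomp Require Import all_boot all_order all_algebra.
From mathcomp Require Import all_classical all_reals all_analysis.
From mathcomp Require Import measurable_realfun.

Set Implicit Arguments.
Unset Strict Implicit.
Unset Printing Implicit Defensive.

Import Order.TTheory GRing.Theory Num.Theory.
Import numFieldNormedType.Exports HBNNSimple.
Local Open Scope classical_set_scope.
Local Open Scope ring_scope.

(** An element m of the span of the delta's is a functional on functions
    vanishing at a, so it can be evaluated at the functions x |-> chi_(a,x](t),
    one for each real t. As t varies this gives a step function, and
    m |-> [t |-> m(chi_(a,.](t))] is linear with delta(x) |-> chi_(a,x]; no choice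
    of a representation of m is involved. The theorem says that this map is an
    isometry for the free norm, that its range is dense in L_p(I), and that
    L_p(I) is complete, so that it extends to a surjective isometry of the
    completion (isometric_extension).

    Isometry (span_Lp_norm). The map x |-> chi_(a,x] into L_p(I) is itself
    1-Lipschitz for |x - y|^(1/p), so the free norm is at least the L_p norm. For
    the converse let f be 1-Lipschitz into a p-normed space Y and cut the line at
    the points y_0 < ... < y_n of the combination (a included). Abel summation
    rewrites sum_j a_j f(x_j) as sum_k b_k (f(y_(k+1)) - f(y_k)), where b_k is
    exactly the value of the step function on (y_k, y_(k+1)]. The p-triangle
    inequality bounds the p-th power of its norm by
    sum_k |b_k|^p (y_(k+1) - y_k), which is the integral of the p-th power of the
    step function (step_pnorm_le).

    Completeness (Lp_complete) is the Riesz-Fischer argument, which for p <= 1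
    works with the metric given by the integral of |f - g|^p: a fast subsequence
    converges almost everywhere, and Fatou's lemma turns this into convergence of
    the whole sequence.

    Density (pintegrable_step_approx). The functions approximable by step
    functions form a vector space closed under dominated limits. Intersected
    with a fixed window (c, d] with end points in I, the Borel sets whose
    indicator is approximable form a Dynkin system containing the half-open
    intervals, hence all Borel sets are reached; simple functions and windows
    exhausting I up to its end points give all of L_p(I). *)

(** * Convergence in p-normed spaces *)

Section pconvergence.
Variables (R : realType) (p : pexponent R) (V : pnormedType p).
Implicit Types (u v : nat -> V) (l m : V).

(** Stated with p-th powers because these satisfy the triangle inequality, which
    for p < 1 may fail for the p-norm itself. *)
Definition pcvg u l : Prop :=
  (fun n => pnorm (u n - l) `^ p) @ \oo --> (0 : R).

Lemma pcvgP u l : pcvg u l <-> forall e : R, 0 < e ->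
  exists N : nat, forall n : nat, (N <= n)%N -> pnorm (u n - l) < e.
Proof.
split=> [ul e e0|ul].
  have /cvgrPdist_lt/(_ (e `^ p))[|N _ HN] := ul; first exact: powR_gt0.
  exists N => n /HN /=; rewrite sub0r normrN ger0_norm ?powR_ge0// => H.
  by rewrite ltNge; apply/negP => /(ler_powp p (ltW e0)); rewrite leNgt H.
apply/cvgrPdist_lt => e e0.
have [N HN] := ul (e `^ (p : R)^-1) (powR_gt0 _ e0).
exists N => // n /= /HN /(ltr_powp p (pnorm_ge0 _)).
by rewrite powRVpK ?ltW// sub0r normrN ger0_norm ?powR_ge0.
Qed.

Lemma pcvg_squeeze u l (b : nat -> R) : b @ \oo --> (0 : R) ->
  (forall n, pnorm (u n - l) `^ p <= b n) -> pcvg u l.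
Proof.
move=> b0 ub; apply: (@squeeze_cvgr _ _ _ _ (cst 0) b) => //; last exact: cvg_cst.
by apply: nearW => n; rewrite powR_ge0/=.
Qed.

Lemma eq_pcvg u v l : u =1 v -> pcvg u l -> pcvg v l.
Proof. by move=> /funext ->. Qed.

Lemma pcvg_cst l : pcvg (fun=> l) l.
Proof.
by rewrite /pcvg; under eq_fun do rewrite subrr pnorm0 powR0 ?pexp_neq0//; exact: cvg_cst.
Qed.

Lemma pcvgZD (a : R) u v l m : pcvg u l -> pcvg v m ->
  pcvg (fun n => a *: u n + v n) (a *: l + m).
Proof.
move=> ul vm.
apply: (@pcvg_squeeze _ _ (fun n => `|a| `^ p * pnorm (u n - l) `^ p
                              + pnorm (v n - m) `^ p)).
  rewrite -[0 in X in _ --> X]addr0 -[0 in X in X + _](mulr0 (`|a| `^ p)).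
  by apply: cvgD => //; exact: cvgMr.
move=> n; rewrite opprD addrACA -scalerBr; apply: le_trans (pnormD _ _) _.
by rewrite pnormZ powRM// pnorm_ge0.
Qed.

Lemma pcvg_norm u l : pcvg u l ->
  (fun n => pnorm (u n) `^ p) @ \oo --> pnorm l `^ p.
Proof.
move=> ul; apply/cvgrPdist_lt => e e0.
have /cvgrPdist_lt/(_ e e0)[N _ HN] := ul.
exists N => // n /= /HN; rewrite sub0r normrN ger0_norm ?powR_ge0//.
by apply: le_lt_trans; rewrite pnormBC; exact: ler_pnorm_dist.
Qed.

Lemma pnorm_inj_powp l (x : R) : 0 <= x -> pnorm l `^ p = x `^ p -> pnorm l = x.
Proof.
by move=> x0 E; rewrite -[LHS](@powRpK R p) ?pnorm_ge0// E powRpK.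
Qed.

Lemma pcvg_unique u l m : pcvg u l -> pcvg u m -> l = m.
Proof.
move=> ul um; have := pcvgZD (-1) ul um.
under eq_fun do rewrite scaleN1r addNr.
move=> /pcvg_norm; rewrite pnorm0 powR0 ?pexp_neq0// scaleN1r => /cvg_lim.
rewrite lim_cst// => /(_ (@Rhausdorff R)) /esym H; apply/esym/eqP.
rewrite -subr_eq0 addrC; apply/eqP/(@pnorm0_eq0 _ p).
by apply: pnorm_inj_powp => //; rewrite H powR0 ?pexp_neq0.
Qed.

Lemma pcvg_pcauchy u l : pcvg u l -> pcauchy u.
Proof.
move=> /pcvgP ul e e0.
have [|N HN] := ul ((e `^ p / 2) `^ (p : R)^-1).
  by rewrite powR_gt0// divr_gt0// powR_gt0.
exists N => m n /HN mN /HN nN; rewrite -[u m](subrK l) -addrA.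
by apply: pnormD_lt => //; rewrite pnormBC.
Qed.

Lemma pcvg_dense (X : Type) (f : X -> V) l :
  (forall e : R, 0 < e -> exists x, pnorm (l - f x) < e) ->
  exists x : nat -> X, pcvg (f \o x) l.
Proof.
move=> dl.
have /choice[x Hx] : forall n : nat, exists x, pnorm (l - f x) < n.+1%:R^-1.
  by move=> n; apply: dl; rewrite invr_gt0.
exists x; apply/pcvgP => e e0.
have [N _ HN] := near_infty_natSinv_lt (PosNum e0).
by exists N => n /HN /=; apply: lt_trans; rewrite pnormBC.
Qed.

Definition pcomplete : Prop := forall u, pcauchy u -> exists l, pcvg u l.

End pconvergence.

(** * Extending a linear isometry to the completion *)

Section extension.
Variables (R : realType) (p : pexponent R) (V W : pnormedType p).
Variable j : {linear V -> W}.
Hypotheses (jnorm : forall x, pnorm (j x) = pnorm x)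
  (jdense : forall w (e : R), 0 < e -> exists x, pnorm (w - j x) < e)
  (Wcomplete : @pcomplete R p W).

(* The graph of the extension: w is the limit of j along a sequence of V
   converging to q. Isometry makes the graph functional. *)
Let ext (q : pcompletion V) (w : W) : Prop :=
  exists x : nat -> V, pcvg (@pcompletion_in _ _ V \o x) q /\ pcvg (j \o x) w.

Let ext_ex q : exists w, ext q w.
Proof.
have [x xq] := pcvg_dense (@pcompletion_in_dense R p V q).
have [|w xw] := Wcomplete (u := j \o x); last by exists w, x.
move=> e e0; have [N HN] := pcvg_pcauchy xq e0.
exists N => m n mN nN; have := HN m n mN nN => /=.
by rewrite -!linearB /= pcompletion_in_norm jnorm.
Qed.

Let ext_lin a q r w z : ext q w -> ext r z -> ext (a *: q + r) (a *: w + z).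
Proof.
move=> [x [xq xw]] [y [yr yz]]; exists (fun n => a *: x n + y n); split.
- by apply: eq_pcvg (pcvgZD a xq yr) => n; apply/esym/pcompletion_in_is_linear.
- by apply: eq_pcvg (pcvgZD a xw yz) => n; apply/esym/linearP.
Qed.

Let ext_norm q w : ext q w -> pnorm w = pnorm q.
Proof.
move=> [x [/pcvg_norm xq /pcvg_norm xw]].
apply: (@pnorm_inj_powp R p) => //; first exact: pnorm_ge0.
apply: (cvg_unique (@Rhausdorff R) xw).
rewrite (_ : (fun n => _) = fun n => pnorm (pcompletion_in (x n)) `^ p) //.
by apply/funext => n; rewrite pcompletion_in_norm /= jnorm.
Qed.

(* The graph is linear, so two values at q differ by a value at 0, which has
   norm 0. *)
Let ext_unique q w z : ext q w -> ext q z -> w = z.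
Proof.
move=> qw qz; have := ext_norm (ext_lin (-1) qz qw).
rewrite !scaleN1r addNr pnorm0 => /(@pnorm0_eq0 _ p) /eqP.
by rewrite addrC subr_eq0 => /eqP.
Qed.

Let T (q : pcompletion V) : W := projT1 (cid (ext_ex q)).

Let TP q : ext q (T q). Proof. by rewrite /T; case: cid. Qed.

Let T_linear : linear T.
Proof. by move=> a q r; apply: ext_unique (TP _) _; exact: ext_lin. Qed.

(** For surjectivity, a sequence of V whose image tends to w is Cauchy by
    isometry, hence converges in the completion, to a preimage of w. *)
Lemma isometric_extension : exists S : {linear pcompletion V -> W},
  [/\ forall q, pnorm (S q) = pnorm q, forall w, exists q, S q = w
    & forall x, S (pcompletion_in x) = j x].
Proof.
pose TL := GRing.isLinear.Build R (pcompletion V) W *:%R T T_linear.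
pose S : {linear pcompletion V -> W} := HB.pack T TL.
exists S; split=> [q|w|x].
- exact: ext_norm (TP q).
- have [x xw] := pcvg_dense (jdense w).
  have [|q xq] := @pcompletion_complete R p V (@pcompletion_in _ _ V \o x).
    move=> e e0; have [N HN] := pcvg_pcauchy xw e0.
    exists N => m n mN nN; have := HN m n mN nN => /=.
    by rewrite -!linearB /= pcompletion_in_norm jnorm.
  by exists q; apply: ext_unique (TP q) _; exists x; split=> //; apply/pcvgP.
- by apply: ext_unique (TP _) _; exists (fun=> x); split; exact: pcvg_cst.
Qed.

End extension.

(** * Subdivisions of the line and Abel summation *)

Section gaps.
Variables (R : realType).
Implicit Types (x y z t : R) (s : seq R).

(** The pairs of consecutive points of the subdivision y :: s. *)
Definition gaps y s : seq (R * R) := zip (y :: s) s.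

(** The last clause says that no point of the subdivision lies strictly inside a
    gap; it makes x |-> (t <= x) constant on the subdivision as t runs through a
    half-open gap. *)
Lemma gapsP y s q : path <%R y s -> q \in gaps y s ->
  [/\ y <= q.1, q.1 < q.2, q.1 \in y :: s, q.2 \in y :: s
    & forall x, x \in y :: s -> x <= q.1 \/ q.2 <= x].
Proof.
elim: s y => //= z s IH y /andP[yz zs]; rewrite inE => /orP[/eqP->|/(IH _ zs)].
  split=> //=; rewrite ?mem_head// ?in_cons ?eqxx ?orbT// => x.
  rewrite inE => /orP[/eqP->|xs]; [by left|right].
  move: xs; rewrite inE => /orP[/eqP->//|xs].
  have /allP/(_ _ xs) := order_path_min (@lt_trans _ R) zs; exact: ltW.
move=> [zq qq q1 q2 H]; split=> //.
- exact: le_trans (ltW yz) zq.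
- by rewrite in_cons q1 orbT.
- by rewrite in_cons q2 orbT.
- move=> x; rewrite inE => /orP[/eqP->|/H//].
  by left; exact: le_trans (ltW yz) zq.
Qed.

Lemma telescope_gaps (Y : zmodType) (F : R -> Y) y s x :
  path <%R y s -> x \in y :: s ->
  F x - F y = \sum_(q <- gaps y s | q.2 <= x) (F q.2 - F q.1).
Proof.
elim: s y => [|z s IH] y ys.
  by rewrite inE => /eqP->; rewrite big_nil subrr.
rewrite inE => /orP[/eqP->|xs].
  rewrite subrr big_seq_cond big1// => q /andP[qs qy].
  have [yq qq _ _ _] := gapsP ys qs.
  by have := le_lt_trans yq (lt_le_trans qq qy); rewrite ltxx.
move: ys => /= /andP[yz zs]; rewrite big_cons /= -IH//.
have zx : z <= x.
  move: xs; rewrite inE => /orP[/eqP->//|xs].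
  by have /allP/(_ _ xs) := order_path_min (@lt_trans _ R) zs; exact: ltW.
by rewrite zx [RHS]addrC addrA subrK.
Qed.

Lemma integral_gaps (f : R -> R) y s : path <%R y s ->
  measurable_fun (setT : set (measurableTypeR R)) f -> (forall t, 0 <= f t) ->
  (forall q t, q \in gaps y s -> q.1 < t <= q.2 -> f t = f q.2) ->
  (\sum_(q <- gaps y s) (f q.2 * (q.2 - q.1)))%:E =
  (\int[lebesgue_measure]_(t in `]y, last y s]%classic) (f t)%:E)%E.
Proof.
move=> + mf f0; elim: s y => [|z s IH] y /=.
  by move=> _ _; rewrite big_nil set_itvoc0 integral_set0.
move=> /andP[yz zs] fc; have zl : z <= last z s.
  have /allP H := order_path_min (@lt_trans _ R) zs.
  by have := mem_last z s; rewrite inE => /orP[/eqP->//|/H/ltW].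
rewrite big_cons EFinD IH//; last first.
  by move=> q t qs; apply: fc; rewrite in_cons qs orbT.
rewrite (@itv_bndbnd_setU _ _ (BRight y) (BRight z)) ?bnd_simp ?(ltW yz)//.
rewrite ge0_integral_setU//=; last 3 first.
- by apply/measurable_EFinP; apply: measurable_funS mf.
- by move=> t _; rewrite lee_fin.
- apply/disj_setPRL => t /=; rewrite !in_itv/= => /andP[zt _].
  by move=> /andP[_]; rewrite leNgt zt.
congr (_ + _)%E.
rewrite (eq_integral (fun=> (f z)%:E)); last first.
  move=> t; rewrite inE/= in_itv/= => ytz; congr EFin.
  by apply: (fc (y, z)) => //; rewrite mem_head.
by rewrite integral_cst//= lebesgue_measure_itv/= lte_fin yz -EFinB -EFinM.
Qed.

End gaps.

Lemma pnorm_sum (R : realType) (p : pexponent R) (Y : pnormedType p) (T : eqType)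
    (r : seq T) (F : T -> Y) :
  pnorm (\sum_(i <- r) F i) `^ p <= \sum_(i <- r) pnorm (F i) `^ p.
Proof.
elim/big_ind2: _ => // [|y1 r1 y2 r2 h1 h2].
  by rewrite pnorm0 powR0 ?pexp_neq0.
by apply: le_trans (pnormD _ _) _; exact: lerD.
Qed.

(** The image of sum_j a_j delta(x_j), where s lists the pairs (a_j, x_j). *)
Definition step (R : realType) (a : R) (s : seq (R * R)) (t : R) : R :=
  \sum_(q <- s) q.1 * chi a q.2 t.

Lemma measurable_step (R : realType) (a : R) s (D : set (measurableTypeR R)) :
  measurable_fun D (step a s : measurableTypeR R -> R).
Proof.
apply: (measurable_sum s (h := fun q t => q.1 * chi a q.2 t)) => q.
by apply: measurable_funM => //; exact: measurable_chi.
Qed.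

(** The half of the isometry that uses the order of the line: by Abel summation
    the vector sum is a combination of the increments of F over the gaps, whose
    coefficients are the values of the step function there. *)
Lemma step_pnorm_le (R : realType) (p : pexponent R) (I : interval R) (a : R)
    (Y : pnormedType p) (F : R -> Y) (s : seq (R * R)) :
  a \in I -> {in s, forall q, q.2 \in I} -> F a = 0 ->
  {in I &, forall x y, pnorm (F x - F y) `^ p <= `|x - y|} ->
  ((pnorm (\sum_(q <- s) q.1 *: F q.2) `^ p)%:E <=
   \int[lebesgue_measure]_(t in ([set` I] : set (measurableTypeR R)))
     (`|step a s t| `^ p)%:E)%E.
Proof.
move=> aI sI Fa FL.
have : sorted <%R (sort <=%R (undup (a :: map snd s))).
  by rewrite lt_sorted_uniq_le sort_uniq undup_uniq sort_le_sorted.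
have : sort <=%R (undup (a :: map snd s)) =i a :: map snd s.
  by move=> x; rewrite mem_sort mem_undup.
case: (sort _ _) => [/(_ a)|y u yu /= pu]; first by rewrite mem_head.
have ua : a \in y :: u by rewrite yu mem_head.
have us q : q \in s -> q.2 \in y :: u.
  by move=> qs; rewrite yu in_cons map_f ?orbT.
have uI x : x \in y :: u -> x \in I.
  by rewrite yu inE => /orP[/eqP->//|/mapP[q /sI qI ->]].
(* The value on a gap is read at its right end point, as gaps are open on the
   left. *)
have -> : \sum_(q <- s) q.1 *: F q.2 =
    \sum_(g <- gaps y u) step a s g.2 *: (F g.2 - F g.1).
  under [RHS]eq_bigr do rewrite scaler_suml.
  rewrite exchange_big /= big_seq [RHS]big_seq; apply: eq_bigr => q qs.
  (* Telescoping starts at the least point y; passing through F a = 0 produces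
     the two indicators of chi. *)
  have -> : F q.2 = (F q.2 - F y) - (F a - F y).
    by rewrite Fa sub0r opprK subrK.
  rewrite !(telescope_gaps F pu) ?us// big_mkcond [X in _ *: (_ - X)]big_mkcond.
  rewrite -sumrB scaler_sumr.
  apply: eq_bigr => g _; rewrite chiE -scalerA scalerBl; congr (_ *: (_ - _)).
    by case: (g.2 <= q.2); rewrite ?scale1r ?scale0r.
  by case: (g.2 <= a); rewrite ?scale1r ?scale0r.
apply: (@le_trans _ _ (\sum_(g <- gaps y u) (`|step a s g.2| `^ p * (g.2 - g.1)))%:E).
  rewrite lee_fin; apply: le_trans (pnorm_sum _ _) _.
  rewrite big_seq [leRHS]big_seq; apply: ler_sum => g /(gapsP pu)[_ gg g1 g2 _].
  rewrite pnormZ powRM ?pnorm_ge0// ler_wpM2l ?powR_ge0//.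
  by rewrite -[leRHS]gtr0_norm ?subr_gt0//; apply: FL; exact: uI.
rewrite (@integral_gaps R (fun t => `|step a s t| `^ p))//.
- apply: ge0_subset_integral => //.
  + by apply: measurable_normpowp; exact: measurable_step.
  + move=> t /=; rewrite in_itv/= => /andP[yt tu].
    have /= := interval_is_interval (i := I) (uI _ (mem_head y u)) (uI _ (mem_last y u)).
    by apply; rewrite (ltW yt) tu.
- apply: (measurableT_comp (measurable_powR _)).
  by apply: measurableT_comp => //; exact: measurable_step.
- move=> g t gu /andP[gt tg]; congr (`|_| `^ _).
  have [_ _ _ _ H] := gapsP pu gu.
  have E x : x \in y :: u -> (t <= x) = (g.2 <= x).
    move=> /H[xg|gx]; last by rewrite gx (le_trans tg gx).
    rewrite !leNgt (le_lt_trans xg gt) (le_lt_trans xg (lt_le_trans gt tg))//.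
  rewrite /step big_seq [RHS]big_seq; apply: eq_bigr => q /us qu.
  by rewrite !chiE !E.
Qed.

(** * Completeness of L_p for p <= 1 *)

Lemma limn_einf_le (R : realType) (u : (\bar R)^nat) (l : \bar R) :
  (\forall n \near \oo, (u n <= l)%E) -> (limn_einf u <= l)%E.
Proof.
move=> [N _ uN]; rewrite limn_einf_lim; apply: lime_le; first exact: is_cvg_einfs.
near=> n; apply: ge_ereal_inf; exists (u (maxn n N)).
  by exists (maxn n N) => //=; rewrite leq_maxl.
by apply: uN; rewrite /= leq_maxr.
Unshelve. all: by end_near. Qed.

Section powp_limits.
Variables (R : realType) (p : pexponent R).

Lemma ler_dist_normr_powp (x y : R) :
  `| `|x| `^ p - `|y| `^ p| <= `|x - y| `^ p.
Proof.
have H (u v : R) : `|u| `^ p - `|v| `^ p <= `|u - v| `^ p.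
  rewrite lerBlDr; apply: le_trans (powRp_subadd _ _ _) => //.
  by apply: ler_powp => //; rewrite -{1}(subrK v u); exact: ler_normD.
by rewrite ler_norml H andbT lerNl opprB (distrC x); exact: H.
Qed.

Lemma cvg_normr_powp (u : nat -> R) (l : R) : u @ \oo --> l ->
  (fun n => `|u n| `^ p) @ \oo --> `|l| `^ p.
Proof.
move=> ul; apply/cvgrPdist_lt => e e0.
have /cvgrPdist_lt/(_ _ (powR_gt0 (p : R)^-1 e0))[N _ HN] := ul.
exists N => // n /HN /= /(ltr_powp p (normr_ge0 _)); rewrite powRVpK ?ltW//.
by apply: le_lt_trans; exact: ler_dist_normr_powp.
Qed.

Lemma powRp_sum (r : nat -> R) n : (forall k, 0 <= r k) ->
  (\sum_(0 <= k < n) r k) `^ p <= \sum_(0 <= k < n) r k `^ p.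
Proof.
move=> r0; elim: n => [|n IH]; first by rewrite !big_nil powR0 ?pexp_neq0.
rewrite !big_nat_recr//=; apply: le_trans (powRp_subadd _ _ _) _ => //.
  exact: sumr_ge0.
by rewrite lerD2r.
Qed.

(** Since p <= 1, summability of the p-th powers of the increments is stronger
    than absolute summability of the increments. *)
Lemma cvg_of_powp_increments (h : nat -> R) :
  (\sum_(0 <= k <oo) (`|h k.+1 - h k| `^ p)%:E < +oo)%E -> cvgn h.
Proof.
set S := (\sum_(0 <= k <oo) _)%E => Soo.
have S0 : (0 <= S)%E by apply: nneseries_ge0 => k _ _; rewrite lee_fin powR_ge0.
have Sf : S \is a fin_num by rewrite ge0_fin_numE.
have : cvgn (series (fun k => h k.+1 - h k)).
  apply: normed_cvg; apply: nondecreasing_is_cvgn.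
    apply/nondecreasing_seqP => n.
    by rewrite [leRHS]big_nat_recr//= lerDl.
  exists (fine S `^ (p : R)^-1) => _ [n _ <-].
  apply: (@ler_powp_inv _ p); first exact: powR_ge0.
  rewrite powRVpK ?fine_ge0//; apply: le_trans (powRp_sum _ _) _ => /=.
    by move=> k; exact: normr_ge0.
  rewrite -lee_fin fineK// -sumEFin.
  by apply: nneseries_lim_ge => k _ _; rewrite lee_fin powR_ge0.
have -> : series (fun k => h k.+1 - h k) = fun n => h n - h 0.
  by apply/funext => n; rewrite /series/= telescope_sumr.
move=> ch; rewrite (_ : h = cst (h 0) \+ (fun n => h n - h 0)).
  by apply: is_cvgD => //; exact: is_cvg_cst.
by apply/funext => n /=; rewrite addrC subrK.
Qed.

End powp_limits.

Section pmass.
Context d (T : measurableType d) (R : realType).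
Variables (p : pexponent R) (mu : {measure set T -> \bar R}).
Variables (D : set T) (mD : measurable D).
Implicit Types f g h : T -> R.

(** The p-th power of the L_p norm; it is subadditive, and applied to differences
    it is the metric used below. *)
Definition pmass f : \bar R := (\int[mu]_(x in D) (`|f x| `^ p)%:E)%E.

Arguments pmass f%_ring_scope.

Lemma pmassB f g : pmass (f \- g) = pmass (g \- f).
Proof. by apply: eq_integral => x _ /=; rewrite distrC. Qed.

Lemma pmass_triangle g f h : measurable_fun D f -> measurable_fun D g ->
  measurable_fun D h -> (pmass (f \- h) <= pmass (f \- g) + pmass (g \- h))%E.
Proof.
move=> mf mg mh; have mfg : measurable_fun D (f \- g) by exact: measurable_funB.
have mgh : measurable_fun D (g \- h) by exact: measurable_funB.
apply: le_trans (pintegralD p mu mD mfg mgh).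
by under [leRHS]eq_integral do rewrite /= addrA subrK.
Qed.

Lemma pmass_fatou f g (h : nat -> T -> R) (e : \bar R) :
  measurable_fun D f -> measurable_fun D g -> (forall k, measurable_fun D (h k)) ->
  {ae mu, forall x, D x -> h^~ x @ \oo --> g x} ->
  (\forall k \near \oo, (pmass (f \- h k) <= e)%E) -> (pmass (f \- g) <= e)%E.
Proof.
move=> mf mg mh hg fhe.
pose F k x := (`|f x - h k x| `^ p)%:E.
have mF k : measurable_fun D (F k).
  by apply: measurable_normpowp; exact: measurable_funB.
have F0 k x : D x -> (0 <= F k x)%E by rewrite lee_fin powR_ge0.
apply: le_trans (limn_einf_le fhe); apply: le_trans (fatou mu mD mF F0).
apply: ae_ge0_le_integral => //.
- by apply: measurable_normpowp; exact: measurable_funB.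
- move=> x Dx; rewrite limn_einf_lim; apply: lime_ge; first exact: is_cvg_einfs.
  by apply: nearW => n; apply: le_ereal_inf_tmp => _ [k _ <-]; exact: F0.
- have -> : (fun x => limn_einf (F^~ x)) =
      (fun x => - limn_esup (fun k => - F k x))%E.
    apply/funext => x; rewrite -limn_einfN; congr limn_einf.
    by apply/funext => k; apply/esym/oppeK.
  apply: measurableT_comp => //; apply: measurable_fun_limn_esup => k.
  exact: measurableT_comp.
- move: hg; apply: filterS => x hg /hg {}hg.
  have fhg : (fun k => `|f x - h k x| `^ p) @ \oo --> `|f x - g x| `^ p.
    by apply: cvg_normr_powp; apply: cvgB => //; exact: cvg_cst.
  have : F^~ x @ \oo --> (`|f x - g x| `^ p)%:E.
    by apply: cvg_EFin; [exact: nearW|exact: fhg].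
  by move=> /cvg_limn_einf_sup[-> _].
Qed.

(** By monotone convergence the sum of |h_(k+1) - h_k|^p is integrable, hence
    finite almost everywhere. *)
Lemma pmass_cauchy_ae_cvg (h : nat -> T -> R) :
  (forall k, measurable_fun D (h k)) ->
  (forall k, (pmass (h k.+1 \- h k) <= (1 / (2 ^ k.+1)%:R)%:E)%E) ->
  {ae mu, forall x, D x -> cvgn (h^~ x)}.
Proof.
move=> mh hc.
have mF k : measurable_fun D (fun x => (`|h k.+1 x - h k x| `^ p)%:E).
  by apply: measurable_normpowp; exact: measurable_funB.
pose G x := (\sum_(0 <= k <oo) (`|h k.+1 x - h k x| `^ p)%:E)%E.
have G0 x : (0 <= G x)%E by apply: nneseries_ge0 => k _ _; rewrite lee_fin powR_ge0.
have iG : mu.-integrable D G.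
  apply/integrableP; split.
    by apply: ge0_emeasurable_sum => // k x _ _; rewrite lee_fin powR_ge0.
  under eq_integral do rewrite gee0_abs//.
  rewrite integral_nneseries//.
  apply: (@le_lt_trans _ _ 1%E); last exact: ltry.
  apply: le_trans (epsilon_trick0 xpredT (@ler01 R)).
  by apply: lee_nneseries => [k _ _|k _]; [exact: pintegral_ge0|exact: hc].
have := integrable_ae mD iG; apply: filterS => x Gx Dx.
by apply: (@cvg_of_powp_increments R p); have := Gx Dx; rewrite ge0_fin_numE.
Qed.

(** The limit is a.e. the pointwise limit of a fast subsequence; the upper limit
    serves as a measurable representative defined everywhere. *)
Lemma pmass_complete (f : nat -> T -> R) :
  (forall n, measurable_fun D (f n)) ->
  (forall e : R, 0 < e -> exists N, forall m n, (N <= m)%N -> (N <= n)%N ->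
     (pmass (f m \- f n) <= e%:E)%E) ->
  exists g, measurable_fun D g /\
    forall e : R, 0 < e -> exists N, forall m, (N <= m)%N ->
     (pmass (f m \- g) <= e%:E)%E.
Proof.
move=> mf fc.
have /choice[N HN] : forall k, exists N, forall m n, (N <= m)%N -> (N <= n)%N ->
    (pmass (f m \- f n) <= (1 / (2 ^ k.+1)%:R)%:E)%E.
  by move=> k; apply: fc; rewrite divr_gt0// ltr0n expn_gt0.
(* Cumulative sums of the moduli N dominate them and increase strictly. *)
pose n k := (\sum_(0 <= i < k.+1) (N i).+1)%N.
have nS k : n k.+1 = (n k + (N k.+1).+1)%N by rewrite /n big_nat_recr.
have nN k : (N k <= n k)%N.
  by rewrite /n big_nat_recr//=; apply: leq_trans (leqnSn _) _; exact: leq_addl.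
have nk k : (k <= n k)%N.
  by elim: k => // k IH; rewrite nS addnS ltnS; exact: leq_trans IH (leq_addr _ _).
pose h k := f (n k).
have hae : {ae mu, forall x, D x -> cvgn (h^~ x)}.
  apply: pmass_cauchy_ae_cvg => [k|k]; first exact: mf.
  by apply: HN; rewrite ?nS ?(leq_trans (nN _) (leq_addr _ _)).
pose g x := fine (limn_esup (fun k => (h k x)%:E)).
have mg : measurable_fun D g.
  apply: (measurableT_comp (fine_measurable measurableT)).
  by apply: measurable_fun_limn_esup => k; apply/measurable_EFinP; exact: mf.
exists g; split=> // e e0; have [M HM] := fc e e0.
exists M => m Mm; apply: (@pmass_fatou _ _ h) => //.
- by move=> k; exact: mf.
- move: hae; apply: filterS => x cx /cx {}cx.
  have /cvg_limn_einf_sup[_ E] : (fun k => (h k x)%:E) @ \oo --> (limn (h^~ x))%:E.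
    by apply: cvg_EFin; [exact: nearW|exact: cx].
  by rewrite /g E; exact: cx.
- by exists M => // k /= Mk; apply: HM => //; exact: leq_trans Mk (nk k).
Qed.

End pmass.

Arguments pmass {d T R} p mu D f%_ring_scope.

Section Lp_complete.
Context d (T : measurableType d) (R : realType).
Variables (p : pexponent R) (mu : {measure set T -> \bar R}).
Variables (D : set T) (mD : measurable D).

Lemma Lp_class_repr (w : Lp p mu mD) :
  Lp_class mD (LpfunP (repr w : Lpfun p mu mD)) = w.
Proof.
rewrite -[RHS]lquot_reprK.
by congr (lquot_pi _ _); exact: val_inj.
Qed.

Lemma pnorm_Lp_classB f g (fi : pintegrable p mu D f) (gi : pintegrable p mu D g) :
  (pnorm (Lp_class mD fi - Lp_class mD gi) `^ p)%:E = pmass p mu D (f \- g).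
Proof.
have ui : pintegrable p mu D (f \- g).
  exact: LpfunP (MkLpfun (Lpfun_mem mD fi) - MkLpfun (Lpfun_mem mD gi)).
have -> : Lp_class mD fi - Lp_class mD gi = Lp_class mD ui.
  by rewrite /Lp_class -linearB; congr (lquot_pi _ _); exact: val_inj.
by rewrite Lp_normE powRVpK ?fine_ge0 ?pintegral_ge0// fineK// pintegral_fin.
Qed.

Lemma Lp_complete : pcomplete (Lp p mu mD).
Proof.
move=> u uc.
pose f n : T -> R := (repr (u n) : Lpfun p mu mD).
have fi n : pintegrable p mu D (f n) by exact: LpfunP.
have Hf n : u n = Lp_class mD (fi n).
  by rewrite -[LHS]Lp_class_repr; congr (lquot_pi _ _); exact: val_inj.
have fu m n : pmass p mu D (f m \- f n) = (pnorm (u m - u n) `^ p)%:E.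
  by rewrite !Hf pnorm_Lp_classB.
have [|g [mg gl]] := @pmass_complete _ _ _ p mu _ mD f (fun n => (fi n).1).
  move=> e e0; have [N HN] := uc _ (powR_gt0 (p : R)^-1 e0).
  exists N => m n Nm Nn; rewrite (fu m n) lee_fin.
  have /ltW := ltr_powp p (pnorm_ge0 _) (HN m n Nm Nn).
  by rewrite powRVpK// ltW.
have gi : pintegrable p mu D g.
  split=> //; have [N /(_ _ (leqnn N)) HN] := gl 1 ltr01.
  have mB : measurable_fun D (g \- f N) by exact: measurable_funB (fi N).1.
  have := pintegralD p mu mD (fi N).1 mB.
  under [in X in (X <= _)%E -> _]eq_integral do rewrite /= addrC subrK.
  move=> /le_lt_trans; apply; apply: lte_add_pinfty; first exact: (fi N).2.
  by rewrite -/(pmass p mu D (g \- f N)) pmassB (le_lt_trans HN)// ltry.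
exists (Lp_class mD gi); apply/pcvgP => e e0.
have ep2 : 0 < e `^ p / 2 by rewrite divr_gt0// powR_gt0.
have [N HN] := gl _ ep2.
exists N => n /HN; rewrite -(pnorm_Lp_classB (fi n) gi) -Hf lee_fin => H.
rewrite ltNge; apply/negP => /(ler_powp p (ltW e0)) /le_trans/(_ H).
by rewrite leNgt ltr_pdivrMr// ltr_pMr ?powR_gt0// ltr1n.
Qed.

End Lp_complete.

(** * Density of step functions in L_p(I) *)

(** Used to exhaust an interval by windows with end points inside it, whatever
    the kind of its bounds. *)
Lemma exists_coinitial_seq (R : realType) (A : set R) : A !=set0 ->
  exists c : nat -> R, (forall n, A (c n)) /\
    forall t, (exists2 x, A x & x < t) -> \forall n \near \oo, c n < t.
Proof.
move=> A0; have [lA|/forallNP nlA] := pselect (has_lbound A).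
  have /choice[c Hc] : forall n : nat, exists x, A x /\ x < inf A + n.+1%:R^-1.
    move=> n; have n0 : (0 : R) < n.+1%:R^-1 by rewrite invr_gt0.
    by have [x Ax xi] := inf_adherent n0 (conj A0 lA); exists x.
  exists c; split=> [n|t [x Ax xt]]; first by case: (Hc n).
  have it : 0 < t - inf A by rewrite subr_gt0 (le_lt_trans _ xt)// ge_inf.
  near=> n; apply: lt_trans (Hc n).2 _; rewrite -ltrBrDl.
  by near: n; exact: (near_infty_natSinv_lt (PosNum it)).
have /choice[c Hc] : forall n : nat, exists x, A x /\ x < - n%:R.
  move=> n; apply: contrapT => /forallNP H; apply: (nlA (- n%:R)) => x Ax.
  by rewrite leNgt; apply/negP => xn; apply: (H x).
exists c; split=> [n|t _]; first by case: (Hc n).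
near=> n; apply: lt_trans (Hc n).2 _; rewrite ltrNl.
by near: n; exact: nbhs_infty_gtr.
Unshelve. all: by end_near. Qed.

Lemma exists_cofinal_seq (R : realType) (A : set R) : A !=set0 ->
  exists c : nat -> R, (forall n, A (c n)) /\
    forall t, (exists2 x, A x & t < x) -> \forall n \near \oo, t < c n.
Proof.
move=> [x0 Ax0].
have [|c [cA cl]] := @exists_coinitial_seq R [set x | A (- x)].
  by exists (- x0); rewrite /= opprK.
exists (fun n => - c n); split=> // t [x Ax tx].
have [|N _ HN] := cl (- t); first by exists (- x); rewrite /= ?opprK// ltrN2.
by exists N => // n /HN; rewrite /= ltrNr.
Qed.

Lemma negligible_subsingleton (R : realType) (B : set (measurableTypeR R)) :
  (forall x y, B x -> B y -> x = y) -> (@lebesgue_measure R).-negligible B.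
Proof.
move=> B1; have [[x Bx]|/forallNP B0] := pselect (exists x, B x).
  exists [set x]; split=> //; first exact: lebesgue_measure_set1.
  by move=> y /B1 /(_ Bx).
by exists set0; split=> // y /B0.
Qed.

Section density.
Variables (R : realType) (p : pexponent R) (I : interval R) (a : R).
Hypothesis aI : a \in I.

Let D : set (measurableTypeR R) := [set` I].
Let mD : measurable D. Proof. exact: measurable_itv. Qed.
Local Notation mass := (pmass p (@lebesgue_measure R) D).
Implicit Types f g : measurableTypeR R -> R.

Definition step_approx f : Prop := forall e : R, 0 < e -> exists s : seq (R * R),
  {in s, forall q, q.2 \in I} /\ (mass (f \- step a s) <= e%:E)%E.

Lemma eq_step_approx f g : f =1 g -> step_approx f -> step_approx g.
Proof. by move=> /funext ->. Qed.

Lemma step_approx_lim f : measurable_fun D f ->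
  (forall e : R, 0 < e -> exists g,
     [/\ measurable_fun D g, step_approx g & (mass (f \- g) <= e%:E)%E]) ->
  step_approx f.
Proof.
move=> mf fg e e0; have e2 : 0 < e / 2 by rewrite divr_gt0.
have [g [mg ag fge]] := fg _ e2; have [s [sI sg]] := ag _ e2.
exists s; split=> //; have mst : measurable_fun D (step a s) by exact: measurable_step.
apply: le_trans (pmass_triangle p lebesgue_measure mD mf mg mst) _.
by rewrite [e]splitr EFinD; apply: leeD; [exact: fge|exact: sg].
Qed.

Lemma step_approx_lin (c : R) f g : measurable_fun D f -> measurable_fun D g ->
  step_approx f -> step_approx g -> step_approx (fun t => c * f t + g t).
Proof.
move=> mf mg af ag e e0; have e2 : 0 < e / 2 by rewrite divr_gt0.
(* The summand 1 covers c = 0. *)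
have c0 : 0 < `|c| `^ p + 1 by rewrite ltr_pwDr// powR_ge0.
have [s [sI fs]] := af _ (divr_gt0 e2 c0); have [r [rI gr]] := ag _ e2.
exists ([seq (c * q.1, q.2) | q <- s] ++ r); split.
  move=> q; rewrite mem_cat => /orP[/mapP[u us ->]|]; [exact: (sI u)|exact: rI].
have mfs : measurable_fun D (f \- step a s).
  by apply: measurable_funB => //; exact: measurable_step.
have mgr : measurable_fun D (g \- step a r).
  by apply: measurable_funB => //; exact: measurable_step.
have mcfs : measurable_fun D (fun t => c * (f \- step a s) t).
  exact: measurable_funM.
have := pintegralD p (@lebesgue_measure R) mD mcfs mgr.
rewrite pintegralZ// => H.
rewrite (_ : mass _ = \int[lebesgue_measure]_(x in D)
    (`|c * (f \- step a s) x + (g \- step a r) x| `^ p)%:E)%E; last first.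
  apply: eq_integral => t _; congr ((`|_| `^ _)%:E) => /=.
  rewrite /step big_cat big_map /= opprD addrACA mulrBr mulr_sumr.
  by congr (_ - _ + _); apply: eq_bigr => q _; rewrite mulrA.
apply: le_trans H _; rewrite [e in leRHS]splitr EFinD; apply: leeD => //.
apply: (@le_trans _ _ ((`|c| `^ p)%:E * (e / 2 / (`|c| `^ p + 1))%:E)%E).
  by apply: lee_wpmul2l; rewrite ?lee_fin ?powR_ge0.
rewrite -EFinM lee_fin mulrCA ger_pMr// ler_pdivrMr// mul1r.
by rewrite lerDl.
Qed.

Lemma step_approx_itv (u v : R) : u \in I -> v \in I ->
  step_approx (\1_(`]u, v]%classic)).
Proof.
move=> uI vI; wlog uv : u v uI vI / u <= v => [H|].
  have [/H|vu] := leP u v; first exact.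
  rewrite set_itv_ge; last by rewrite bnd_simp -leNgt ltW.
  by have := H u u uI uI (lexx u); rewrite set_itvoc0.
move=> e e0; exists [:: (1, v); (-1, u)]; split.
  by move=> q; rewrite !inE => /orP[] /eqP ->.
rewrite (_ : mass _ = 0%E) ?lee_fin ?(ltW e0)//; apply: integral0_eq => t _ /=.
rewrite /step big_cons big_seq1/= mul1r mulN1r chiB.
by rewrite /chi uv subrr normr0 powR0 ?pexp_neq0.
Qed.

(** Dominated convergence, with the p-integrable bound g on the errors. *)
Lemma step_approx_dominated f (h : nat -> measurableTypeR R -> R) g :
  measurable_fun D f -> (forall n, measurable_fun D (h n)) ->
  (forall n, step_approx (h n)) ->
  {ae @lebesgue_measure R, forall x, D x -> h^~ x @ \oo --> f x} ->
  pintegrable p (@lebesgue_measure R) D g ->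
  (forall n x, D x -> `|f x - h n x| <= `|g x|) -> step_approx f.
Proof.
move=> mf mh ah hf [mg gi] fhg; apply: step_approx_lim => // e e0.
pose F n x := (`|f x - h n x| `^ p)%:E.
have mF n : measurable_fun D (F n).
  by apply: measurable_normpowp; exact: measurable_funB.
have [] := @dominated_convergence _ _ _ (@lebesgue_measure R) D mD F (cst 0%E)
    (fun x => (`|g x| `^ p)%:E) mF.
- exact: measurable_cst.
- move: hf; apply: filterS => x hf Dx.
  have fhx : (fun n => `|f x - h n x| `^ p) @ \oo --> (0 : R).
    rewrite -[0 in X in _ --> X](powR0 (pexp_neq0 p)) -(normr0 R) -(subrr (f x)).
    apply: cvg_normr_powp; apply: cvgB; [exact: cvg_cst|exact: hf].
  by apply: cvg_EFin; [exact: nearW|exact: fhx].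
- apply/integrableP; split; first exact: measurable_normpowp.
  by under eq_integral do rewrite gee0_abs ?lee_fin ?powR_ge0//.
- apply: aeW => x n Dx; rewrite gee0_abs ?lee_fin ?powR_ge0//.
  exact: ler_powp (fhg n x Dx).
rewrite integral_cst// mul0e => _ _ /fine_cvgP[Ff /cvgrPdist_lt/(_ e e0) Fe].
near \oo => n; exists (h n); split=> //.
have fin : (\int[lebesgue_measure]_(x in D) F n x)%E \is a fin_num by near: n.
rewrite -[leLHS]fineK// lee_fin; apply: ltW.
have : `|0 - fine (\int[lebesgue_measure]_(x in D) F n x)%E| < e by near: n.
by rewrite sub0r normrN; apply: le_lt_trans; exact: ler_norm.
Unshelve. all: by end_near. Qed.

Lemma step_approx_sum (T : Type) (r : seq T) (F : T -> measurableTypeR R -> R) :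
  (forall i, measurable_fun D (F i)) -> (forall i, step_approx (F i)) ->
  step_approx (fun t => \sum_(i <- r) F i t).
Proof.
move=> mF aF; elim: r => [|i r IH].
  apply: eq_step_approx (step_approx_itv aI aI) => t.
  by rewrite set_itvoc0 indic0 big_nil.
apply: eq_step_approx (step_approx_lin 1 (mF i) _ (aF i) IH) => [t|].
  by rewrite big_cons mul1r.
exact: measurable_sum.
Qed.

(* Cutting with a window keeps indicators p-integrable and makes their step
   approximations use points of I only. *)
Section window.
Variables (c d : R).
Hypotheses (cI : c \in I) (dI : d \in I).
Let J : set (measurableTypeR R) := `]c, d]%classic.
Let mJ : measurable J. Proof. exact: measurable_itv. Qed.

Let ind (E : set (measurableTypeR R)) : measurableTypeR R -> R := \1_(E `&` J).

Let mind (E : set (measurableTypeR R)) : measurable E -> measurable_fun D (ind E).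
Proof. by move=> mE; apply: measurable_indic; exact: measurableI. Qed.

Let pintegrable_indJ : pintegrable p (@lebesgue_measure R) D (\1_J).
Proof.
split; first exact: measurable_indic.
apply: (@le_lt_trans _ _ (\int[lebesgue_measure]_(t in D) (\1_J t)%:E)%E).
  apply: ge0_le_integral => //.
  - by apply: measurable_normpowp; exact: measurable_indic.
  - by apply/measurable_EFinP; exact: measurable_indic.
  - move=> t _; rewrite lee_fin indicE; case: (_ \in _).
      by rewrite normr1 powR1.
    by rewrite normr0 powR0 ?pexp_neq0.
rewrite integral_indic//; apply: (@le_lt_trans _ _ (lebesgue_measure J)).
  by apply: le_measure; rewrite ?inE//; exact: measurableI.
by rewrite lebesgue_measure_itv/=; case: ifP => _; rewrite ?ltry// -EFinB ltry.
Qed.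

(** Disjoint countable unions are dominated limits of partial sums, so the sets E
    in question form a Dynkin system, which contains the pi-system of half-open
    intervals generating the Borel sets. *)
Lemma step_approx_indic (E : set (measurableTypeR R)) : measurable E ->
  step_approx (ind E).
Proof.
have aJ : step_approx (ind setT) by rewrite /ind setTI; exact: step_approx_itv.
have mT : measurable (setT : set (measurableTypeR R)) by [].
move=> mE; apply: (@dynkin_induction _ (measurableTypeR R) R.-ocitv.-measurable
  (fun E => step_approx (ind E)) erefl _ aJ _ _ _ E mE).
- exact: ocitvI.
- move=> _ [[u v] _ <-] /=; rewrite /ind.
  have -> : `]u, v]%classic `&` J = `]Num.max u c, Num.min v d]%classic.
    rewrite /J; apply/seteqP; split=> t /=; rewrite !in_itv/= gt_max le_min.
      by move=> [/andP[-> ->] /andP[-> ->]].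
    by move=> /andP[/andP[-> ->] /andP[-> ->]].
  have [mm|mm] := leP (Num.max u c) (Num.min v d); last first.
    rewrite set_itv_ge; last by rewrite bnd_simp -leNgt ltW.
    by have := step_approx_itv cI cI; rewrite set_itvoc0.
  have cu : c <= Num.max u c by rewrite le_max lexx orbT.
  have vd : Num.min v d <= d by rewrite ge_min lexx orbT.
  have cd := interval_is_interval cI dI.
  by apply: step_approx_itv; apply: cd; rewrite ?cu ?vd ?(le_trans cu mm) ?(le_trans mm vd).
- move=> S mS aS; have := step_approx_lin (-1) (mind mS) (mind mT) aS aJ.
  apply: eq_step_approx => t; rewrite /ind !indicE !in_setI in_setC in_setT.
  by case: (t \in S); case: (t \in J); rewrite /= ?mulr1 ?mulr0 ?addNr ?add0r.
- move=> F mF tF aF; have mU : measurable (\bigcup_k F k) by exact: bigcup_measurable.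
  (* The partial sums of the disjoint union; at a point of F m they jump from 0 to
     the value of the full indicator at n = m + 1. *)
  pose h n t := \sum_(k <- iota 0 n) ind (F k) t.
  have hE m t n : F m t -> h n t = ((t \in J) && (m < n)%N)%:R.
    move=> Ft; have Fk k : ind (F k) t = ((t \in J) && (k == m))%:R.
      rewrite /ind indicE in_setI andbC; congr ((_ && _)%:R).
      apply/idP/eqP => [|->]; last by rewrite inE.
      by rewrite inE => Fkt; apply: tF => //; exists t.
    rewrite /h (eq_bigr _ (fun k _ => Fk k)); case: (t \in J) => /=; last by rewrite big1.
    have [mn|nm] := ltnP m n; last first.
      rewrite big_seq big1// => k; rewrite mem_iota add0n /= => kn.
      by case: eqVneq kn nm => // ->; case: ltngtP.
    rewrite (bigD1_seq m) ?iota_uniq ?mem_iota//= eqxx big1 ?addr0// => k.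
    by move=> /negbTE ->.
  have fE m t : F m t -> ind (\bigcup_k F k) t = (t \in J)%:R.
    move=> Ft; rewrite /ind indicE in_setI (_ : t \in \bigcup_k F k)//.
    by rewrite inE; exists m.
  have nF t : ~ (exists m, F m t) -> (forall n, h n t = 0) /\ ind (\bigcup_k F k) t = 0.
    move=> nF; split=> [n|].
      rewrite /h big1// => k _; rewrite /ind indicE memNset// => -[Fkt _].
      by apply: nF; exists k.
    by rewrite /ind indicE memNset// => -[[m _ Fmt] _]; apply: nF; exists m.
  apply: (@step_approx_dominated _ h _ (mind mU) _ _ _ pintegrable_indJ).
  + by move=> n; apply: measurable_sum => k; exact: mind.
  + by move=> n; apply: step_approx_sum => // k; exact: mind.
  + apply: aeW => t _; have [[m Ft]|/nF[h0 ->]] := pselect (exists m, F m t); last first.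
      by rewrite (_ : h^~ t = cst 0); [exact: cvg_cst|exact/funext].
    rewrite (fE _ _ Ft); apply: cvg_near_cst; exists m.+1 => // n /= mn.
    by rewrite (hE _ _ _ Ft) mn andbT.
  + move=> n t _; have [[m Ft]|/nF[-> ->]] := pselect (exists m, F m t); last first.
      by rewrite subrr normr0.
    rewrite (fE _ _ Ft) (hE _ _ _ Ft) indicE.
    by case: (t \in J); case: (m < n)%N; rewrite /= ?subrr ?subr0 ?normr0.
Qed.

End window.

Lemma step_approx_scale (c : R) f : measurable_fun D f -> step_approx f ->
  step_approx (fun t => c * f t).
Proof.
move=> mf af; have m0 : measurable_fun D (cst 0 : measurableTypeR R -> R) by [].
have a0 : step_approx (cst 0).
  apply: eq_step_approx (@step_approx_sum nat [::] (fun _ => f) _ _) => // t.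
  by rewrite big_nil.
by apply: eq_step_approx (step_approx_lin c mf m0 af a0) => t; rewrite addr0.
Qed.

Lemma step_approx_nnsfun (g : {nnsfun (measurableTypeR R) >-> R}) (c d : R) :
  c \in I -> d \in I -> step_approx (fun t => g t * \1_(`]c, d]%classic) t).
Proof.
move=> cI dI; pose F (y : R) (t : measurableTypeR R) :=
  y * \1_(g @^-1` [set y] `&` `]c, d]%classic) t.
have mg y : measurable (g @^-1` [set y]).
  by apply: measurable_funPTI; exact: measurable_set1.
have mi y : measurable_fun D (\1_(g @^-1` [set y] `&` `]c, d]%classic) : _ -> R).
  by apply: measurable_indic; apply: measurableI; [exact: mg|exact: measurable_itv].
apply: eq_step_approx (@step_approx_sum _
    (finmap.enum_fset (fset_set (range g))) F _ _).
- move=> t; rewrite [X in X * _]fimfunE fsbig_finite ?mulr_suml; last exact: fimfunP.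
  by apply: eq_bigr => y _; rewrite /F indicI/= mulrA.
- by move=> y; exact: measurable_funM.
- by move=> y; apply: step_approx_scale => //; exact: step_approx_indic.
Qed.

(** The points left out are the least and greatest elements of I, if any. *)
Lemma ae_inner_itv : {ae @lebesgue_measure R, forall t, D t ->
  (exists2 x, D x & x < t) /\ (exists2 x, D x & t < x)}.
Proof.
have lo : (@lebesgue_measure R).-negligible [set t | D t /\ forall x, D x -> t <= x].
  apply: negligible_subsingleton => x y [Dx xD] [Dy yD].
  by apply/le_anti; rewrite xD// yD.
have hi : (@lebesgue_measure R).-negligible [set t | D t /\ forall x, D x -> x <= t].
  apply: negligible_subsingleton => x y [Dx xD] [Dy yD].
  by apply/le_anti; rewrite xD// yD.
apply: negligibleS (negligibleU lo hi) => t /=.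
rewrite not_implyE => -[Dt /not_andP[H|H]]; [left|right]; split=> // x Dx;
  by rewrite leNgt; apply/negP => xt; apply: H; exists x.
Qed.

(** Simple functions increasing to f, cut by windows increasing to I, are
    dominated by f and converge to it away from the end points of I. *)
Lemma step_approx_nonneg f : pintegrable p (@lebesgue_measure R) D f ->
  (forall t, 0 <= f t) -> step_approx f.
Proof.
move=> [mf fi] f0.
have [|c [cI cl]] := @exists_coinitial_seq R D; first by exists a.
have [|d [dI dl]] := @exists_cofinal_seq R D; first by exists a.
have mEf : measurable_fun D (EFin \o f) by exact/measurable_EFinP.
pose g := nnsfun_approx mD mEf.
have gf t : D t -> (fun n => g n t) @ \oo --> f t.
  move=> Dt; have Ef0 x : D x -> (0 <= (EFin \o f) x)%E by move=> _; rewrite lee_fin.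
  by have /fine_cvg := cvg_nnsfun_approx mD mEf Ef0 Dt.
have gle n t : D t -> g n t <= f t.
  move=> Dt; rewrite -(cvg_lim (@Rhausdorff R) (gf t Dt)).
  apply: nondecreasing_cvgn_le; last by apply/cvg_ex; exists (f t); exact: gf.
  by move=> i j ij; have /lefP := nd_nnsfun_approx mD mEf ij; exact.
pose h n (t : measurableTypeR R) := g n t * \1_(`]c n, d n]%classic) t.
apply: (@step_approx_dominated f h f) => //.
- move=> n; apply: measurable_funM; last exact: measurable_indic.
  by apply: measurable_funTS; exact: measurable_funP.
- by move=> n; apply: step_approx_nnsfun; [exact: cI|exact: dI].
- have := ae_inner_itv; apply: filterS => t H Dt; have [/cl ct /dl td] := H Dt.
  apply: cvg_trans (gf t Dt); apply: near_eq_cvg; near=> n.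
  rewrite /h indicE mem_set ?mulr1//= in_itv/=; apply/andP; split; near: n => //.
  by move: td; apply: filterS => n; exact: ltW.
- move=> n t Dt; rewrite !ger0_norm ?f0// /h indicE; case: (t \in _) => /=.
  + by rewrite mulr1 gerBl.
  + by rewrite mulr0 subr0.
  + by rewrite mulr1 subr_ge0 gle.
  + by rewrite mulr0 subr0.
Unshelve. all: by end_near. Qed.

Lemma pintegrable_step_approx f : pintegrable p (@lebesgue_measure R) D f ->
  step_approx f.
Proof.
move=> [mf fi].
have part (h : measurableTypeR R -> R) : measurable_fun D h ->
    (forall t, 0 <= h t <= `|f t|) -> step_approx h.
  move=> mh hf; apply: step_approx_nonneg => [|t]; last by case/andP: (hf t).
  split; first exact: mh.
  apply: le_lt_trans fi; apply: ge0_le_integral => //.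
  - exact: measurable_normpowp.
  - exact: measurable_normpowp.
  - move=> t _; have /andP[h0 hft] := hf t.
    by rewrite lee_fin ler_powp// ger0_norm.
have mp := measurable_funrpos mf; have mn := measurable_funrneg mf.
have ap : step_approx f^\+%R.
  by apply: part => // t; rewrite /funrpos le_max lexx orbT ge_max ler_norm normr_ge0.
have an : step_approx f^\-%R.
  apply: part => // t; rewrite /funrneg le_max lexx orbT ge_max normr_ge0 andbT.
  by rewrite -normrN ler_norm.
apply: eq_step_approx (step_approx_lin (-1) mn mp an ap) => t.
by rewrite mulN1r addrC -[in RHS](funrposBneg f).
Qed.

End density.

(** * The free space of an interval *)

Section free_space_of_interval.
Variables (R : realType) (p : pexponent R) (I : interval R) (a : itv_point p I).
Implicit Types (s : seq (R * itv_point p I)) (m : delta_span a).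

Local Notation comb := (@delta_comb R p (itv_point p I) a).
Let D : set (measurableTypeR R) := [set` I].
Let mD : measurable D. Proof. exact: measurable_itv. Qed.

Lemma itv_pointP (x : itv_point p I) : val x \in I.
Proof. exact: valP. Qed.

Lemma chi_base (t : R) : chi (val a) (val a) t = 0.
Proof. by rewrite chiE subrr. Qed.

(** The function of x for fixed t, which vanishes at the base point and can
    therefore be fed to elements of the span. *)
Definition chi_based (t : R) : based_fun a :=
  exist _ (fun x : itv_point p I => chi (val a) (val x) t) (chi_base t).

Definition span_step m : R -> R := fun t => m (chi_based t).

Definition coords s : seq (R * R) := [seq (q.1, val q.2) | q <- s].

Lemma span_stepE m s : m = comb s :> (based_fun a -> R) ->
  span_step m = step (val a) (coords s).
Proof.
move=> ms; apply/funext => t.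
by rewrite /span_step ms delta_combE /step big_map.
Qed.

Lemma span_comb m : exists s, m = comb s :> (based_fun a -> R).
Proof. by apply/asboolP; exact: delta_span_prop. Qed.

Lemma pintegrable_span_step m : pintegrable p (@lebesgue_measure R) D (span_step m).
Proof.
have [s /span_stepE ->] := span_comb m.
suff : step (val a) (coords s) \in Lpfun_pred p (@lebesgue_measure R) mD.
  by move=> /asboolP.
have -> : step (val a) (coords s) =
    \sum_(q <- coords s) q.1 *: (chi (val a) q.2 : measurableTypeR R -> R).
  apply/funext => t; rewrite /step.
  by elim/big_ind2: _ => // x1 x2 y1 y2 -> ->.
apply: rpred_sum => q _; apply: rpredZ.
by apply/asboolP; exact: pintegrable_chi.
Qed.

Definition span_Lp m : Lp_itv p I := Lp_class (measurable_itvR I) (pintegrable_span_step m).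

Lemma span_Lp_is_linear : linear span_Lp.
Proof.
move=> c m n; rewrite /span_Lp /Lp_class -linearP; congr (lquot_pi _ _).
exact: val_inj.
Qed.

HB.instance Definition _ :=
  GRing.isLinear.Build R (delta_span a) (Lp_itv p I) _ span_Lp span_Lp_is_linear.

Lemma span_Lp_powp m : (pnorm (span_Lp m) `^ p)%:E = pmass p (@lebesgue_measure R) D (span_step m).
Proof.
rewrite Lp_normE powRVpK ?fine_ge0 ?pintegral_ge0// fineK//.
by apply: pintegral_fin; exact: pintegrable_span_step.
Qed.

Lemma Lp_chi_lipschitz1 :
  lipschitz1 (fun x : itv_point p I => Lp_chi p I (val a) (val x)).
Proof.
move=> x y; apply: (@ler_powp_inv _ p); first exact: pdist_ge0.
have E := pnorm_Lp_classB (measurable_itvR I)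
  (pintegrable_chi p (val a) (val x) (measurable_itvR I))
  (pintegrable_chi p (val a) (val y) (measurable_itvR I)).
rewrite -lee_fin [leLHS]E /pdist/= /itv_pdist powRVpK//.
apply: le_trans (pintegral_chi_le p (val y) (val x) mD).
rewrite le_eqVlt; apply/orP; left; apply/eqP/eq_integral => t _.
by rewrite /= (chiB (val a)).
Qed.

Lemma span_Lp_delta (x : itv_point p I) :
  span_Lp (MkDeltaSpan (delta_in_span a x)) = Lp_chi p I (val a) (val x).
Proof. by congr (lquot_pi _ _); exact: val_inj. Qed.

Lemma span_Lp_comb m s : m = comb s :> (based_fun a -> R) ->
  span_Lp m = \sum_(q <- s) q.1 *: Lp_chi p I (val a) (val q.2).
Proof.
move=> ms.
have -> : m = \sum_(q <- s) q.1 *: MkDeltaSpan (delta_in_span a q.2).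
  by apply: val_inj; rewrite /= ms (big_morph (@delta_span_val _ _ _ a) (id1 := 0) (op1 := +%R)).
rewrite linear_sum; apply: eq_bigr => q _.
by rewrite linearZ/= span_Lp_delta.
Qed.

(** At the base point delta is the zero functional. *)
Lemma Lp_chi_base : Lp_chi p I (val a) (val a) = 0.
Proof.
rewrite -span_Lp_delta (_ : MkDeltaSpan _ = 0) ?linear0//.
by apply: val_inj; apply/funext => f; exact: (svalP f).
Qed.

(** The lower bound for the free norm tests it against the 1-Lipschitz map
    x |-> chi_(a,x]; the upper bound is Abel summation. *)
Lemma span_Lp_norm m : pnorm (span_Lp m) = pnorm m.
Proof.
have [s ms] := span_comb m.
apply/eqP; rewrite eq_le; apply/andP; split.
  apply: ub_le_sup; first exact/free_norm_has_ub/delta_span_prop.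
  exists s, (Lp_itv p I), (fun x => Lp_chi p I (val a) (val x)); split.
  - exact: ms.
  - exact: Lp_chi_lipschitz1.
  - exact: Lp_chi_base.
  - by rewrite (span_Lp_comb ms).
apply: ge_sup; first by exists 0; exact: free_norm_set0 (delta_span_prop m).
move=> _ [r [Y [f [mr lf f0 ->]]]].
apply: (@ler_powp_inv _ p); first exact: pnorm_ge0.
rewrite -lee_fin span_Lp_powp (span_stepE mr).
have := @step_pnorm_le R p I (val a) Y (fun x => f (insubd a x)) (coords r) (itv_pointP a).
rewrite big_map /= => H; under eq_bigr => q _ do rewrite -(valKd a q.2); apply: H.
- by move=> _ /mapP[q _ ->]; exact: itv_pointP.
- by rewrite valKd.
- move=> x y xI yI; rewrite -[leRHS](@powRVpK R p)//.
  apply: ler_powp; first exact: pnorm_ge0.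
  by apply: le_trans (lf _ _) _; rewrite /pdist/= /itv_pdist !insubdK.
Qed.

Lemma span_Lp_dense (w : Lp_itv p I) (e : R) : 0 < e ->
  exists m, pnorm (w - span_Lp m) < e.
Proof.
move=> e0; rewrite -(Lp_class_repr w).
set f := repr w; have fi : pintegrable p (@lebesgue_measure R) D f by exact: LpfunP.
have ep2 : 0 < e `^ p / 2 by rewrite divr_gt0// powR_gt0.
have [s [sI fs]] := pintegrable_step_approx (itv_pointP a) fi ep2.
pose r := [seq (q.1, insubd a q.2) | q <- s].
have rP : comb r \in @delta_span_pred R p _ a by apply/asboolP; exists r.
pose m := MkDeltaSpan rP; exists m.
have sr : coords r = s.
  rewrite /coords -map_comp -[RHS]map_id; apply/eq_in_map => -[x y] xy.
  by rewrite /= insubdK//; exact: (sI _ xy).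
have ms : span_step m = step (val a) s by rewrite (@span_stepE m r)// sr.
rewrite ltNge; apply/negP => /(ler_powp p (ltW e0)).
rewrite -lee_fin pnorm_Lp_classB ms => /le_trans/(_ fs).
by rewrite lee_fin leNgt ltr_pdivrMr// ltr_pMr ?powR_gt0// ltr1n.
Qed.

End free_space_of_interval.

Theorem theorem4p13 (R : realType) (p : pexponent R) (I : interval R)
    (a : itv_point p I) :
  exists T : {linear lipfree a -> Lp_itv p I},
    [/\ forall mu : lipfree a, pnorm (T mu) = pnorm mu,
        forall g : Lp_itv p I, exists mu : lipfree a, T mu = g
      & forall x : itv_point p I,
          T (lipfree_delta a x) = Lp_chi p I (val a) (val x)].
Proof.
have [T [Tnorm Tsurj Tin]] := isometric_extension (@span_Lp_norm R p I a)
  (@span_Lp_dense R p I a) (@Lp_complete _ _ R p _ _ (measurable_itvR I)).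
exists T; split; [exact: Tnorm|exact: Tsurj|move=> x].
by rewrite -span_Lp_delta; exact: Tin.
Qed.
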